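(* Let $p$ be an odd prime, $\omega_1,\ldots,\omega_N,x\in\mathbb C_p^\times$, $\bar\omega=(\omega_1,\ldots,\omega_N)$, and suppose $|x|_p>\|\bar\omega\|_p$. Then there is an identity of analytic functions $$\zeta_{p,E,N}(s,x;\bar\omega)=\langle x\rangle^{1-s}\sum_{j=0}^\infty\binom{1-s}{j}E_{N,j}(0;\bar\omega)x^{-j}$$ on a disc of positive radius about $s=0$. If in addition $\omega_1,\ldots,\omega_N,x$ lie in a finite extension $K$ of $\mathbb Q_p$ whose ramification index over $\mathbb Q_p$ is less than $p-1$, then this formula is valid for all $s\in\mathbb C_p$ with $|s|_p<|\pi|_p^{-1}p^{-1/(p-1)}$, where $(\pi)$ is the maximal ideal of the ring of integers $O_K$ of $K$.
   Context: $|\cdot|_p$ is normalized by $|p|_p=p^{-1}$, $v_p$ is the valuation, $\|\bar\omega\|_p=\max_i|\omega_i|_p$. For $x=p^ru\in\mathbb C_p^\times$ with $p^r$ a positive rational power of $p$ (via a fixed embedding $\overline{\mathbb Q}\hookrightarrow\mathbb C_p$) and $|u|_p=1$, $\hat x$ is the root of unity of order prime to $p$ with $|u-\hat x|_p<1$, and $\langle x\rangle=p^{-v_p(x)}x/\hat x$. Fermionic integral $\int_{\mathbb Z_p}f\,d\mu_{-1}=\lim_{m\to\infty}\sum_{a=0}^{p^m-1}f(a)(-1)^a$; $\int_{\mathbb Z_p^N}\cdot\,d\mu_{-1}(\bar t)$ is the iterated integral. Let $\Lambda$ be the $\mathbb Z_p$-span of the $\omega_i$; for $x\notin\Lambda$,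 $\zeta_{p,E,N}(s,x;\bar\omega)=\int_{\mathbb Z_p^N}\langle x+\bar\omega\cdot\bar t\rangle^{1-s}d\mu_{-1}(\bar t)$. Euler polynomials: $\frac{2^Ne^{xt}}{\prod_{j=1}^N(e^{\omega_jt}+1)}=\sum_{n\ge0}E_{N,n}(x;\bar\omega)\frac{t^n}{n!}$. *)

(* Defs.v *)
From HB Require Import structures.
From mathcomp Require Import all_boot all_order all_algebra all_field.
From mathcomp Require Import boolp classical_sets functions reals topology.
From mathcomp Require Import normedtype sequences exp.

Set Implicit Arguments.
Unset Strict Implicit.
Unset Printing Implicit Defensive.

Import Order.TTheory GRing.Theory Num.Theory.
Import numFieldNormedType.Exports.

Local Open Scope classical_set_scope.
Local Open Scope ring_scope.

(** ** Convergence and p-adic numbers in a valued field *)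

Definition vf_cvg (R : realType) (F : fieldType) (v : F -> R)
    (u : nat -> F) (l : F) : Prop :=
  v (u n - l) @[n --> \oo] --> (0 : R).

Definition vf_cauchy (R : realType) (F : fieldType) (v : F -> R)
    (u : nat -> F) : Prop :=
  forall e : R, 0 < e ->
    exists n0, forall m n, (n0 <= m)%N -> (n0 <= n)%N -> v (u m - u n) < e.

(** The closure of the rationals: when [v] extends the p-adic absolute value
    and [F] is complete, this is the copy of Q_p inside [F]. *)
Definition vf_Qp (R : realType) (F : fieldType) (v : F -> R) : set F :=
  [set y | exists q : nat -> rat, vf_cvg v (fun n => ratr (q n)) y].

(** C_p is the completion of an algebraic closure of Q_p.  Up to isometric
    isomorphism it is the only algebraically closed, complete,
    non-archimedean valued field with |p| = 1/p in which the elements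
    algebraic over the closure Q_p of the rationals are dense. *)
Record padicComplex (R : realType) (p : nat) := PadicComplex {
  Cp_field :> closedFieldType;
  absp : Cp_field -> R;
  absp_ge0 : forall y, 0 <= absp y;
  absp_eq0 : forall y, absp y = 0 <-> y = 0;
  abspM : forall y z, absp (y * z) = absp y * absp z;
  absp_ultra : forall y z, absp (y + z) <= Num.max (absp y) (absp z);
  absp_p : absp p%:R = p%:R^-1;
  Cp_complete : forall u, vf_cauchy absp u -> exists l, vf_cvg absp u l;
  Cp_dense : forall (z : Cp_field) (e : R), 0 < e ->
    exists y : Cp_field, absp (z - y) < e /\
      exists q : {poly Cp_field},
        [/\ q != 0, (forall i, vf_Qp absp q`_i) & root q y]
}.

Arguments absp {R p p0} y : rename.

Definition cvgp (R : realType) (p : nat) (C : padicComplex R p)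
    (u : nat -> C) (l : C) : Prop := vf_cvg (@absp R p C) u l.

Definition is_sump (R : realType) (p : nat) (C : padicComplex R p)
    (u : nat -> C) (l : C) : Prop := cvgp (fun n => \sum_(i < n) u i) l.

Definition Qp (R : realType) (p : nat) (C : padicComplex R p) : set C :=
  vf_Qp (@absp R p C).
Arguments Qp {R p} C _.

Definition Zp (R : realType) (p : nat) (C : padicComplex R p) : set C :=
  [set y | Qp C y /\ absp y <= 1].
Arguments Zp {R p} C _.

Definition analytic_disc (R : realType) (p : nat) (C : padicComplex R p)
    (F : C -> C) (r : R) : Prop :=
  exists a : nat -> C,
    forall s, absp s < r -> is_sump (fun n => a n * s ^+ n) (F s).

(** ** The projection <x> and its powers *)

(** The positive real number p^r, as an algebraic number: [n.-root] of a
    nonnegative real is its nonnegative real n-th root. *)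
Definition prat (p : nat) (r : rat) : algC :=
  (`|denq r|%N).-root ((p%:R : algC) ^ numq r).

(** The value group of C_p is p^Q, so for y != 0 the set below is a
    singleton; likewise for [hatp]. *)
Definition vp (R : realType) (p : nat) (C : padicComplex R p) (y : C) : rat :=
  xget 0 [set r : rat | absp y = p%:R `^ (- ratr r)].

Definition hatp (R : realType) (p : nat) (C : padicComplex R p)
    (iota : {rmorphism algC -> C}) (y : C) : C :=
  xget 1 [set w : C |
    (exists n, n.-primitive_root w /\ coprime n p) /\
    absp (y / iota (prat p (vp y)) - w) < 1].

Definition angle (R : realType) (p : nat) (C : padicComplex R p)
    (iota : {rmorphism algC -> C}) (y : C) : C :=
  iota (prat p (- vp y)) * y / hatp iota y.

Definition binomp (F : fieldType) (s : F) (n : nat) : F :=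
  (\prod_(i < n) (s - i%:R)) / (n`!)%:R.

(** [is_powp y s l]: y^s = l, where y^s is the binomial series
    sum_n binom(s,n) (y-1)^n, defined when it converges. *)
Definition is_powp (R : realType) (p : nat) (C : padicComplex R p)
    (y s l : C) : Prop :=
  is_sump (fun n => binomp s n * (y - 1) ^+ n) l.

(** ** Fermionic integrals and the zeta function *)

Definition is_fermionic (R : realType) (p : nat) (C : padicComplex R p)
    (f : C -> C) (l : C) : Prop :=
  cvgp (fun m => \sum_(a < p ^ m) f a%:R * (-1) ^+ a) l.

(** Integral over Z_p^N, the first coordinate being the outermost one; the
    inner integrals are required to exist for every value in Z_p of the outer
    variables. *)
Fixpoint is_fermionicN (R : realType) (p : nat) (C : padicComplex R p)
    (N : nat) : (N.-tuple C -> C) -> C -> Prop :=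
  match N with
  | 0 => fun f l => l = f [tuple]
  | N'.+1 => fun f l =>
      exists2 g : C -> C,
        (forall t, Zp C t ->
           is_fermionicN (fun ts : N'.-tuple C => f [tuple of t :: ts]) (g t))
        & is_fermionic g l
  end.

Definition dotp (F : fieldType) (N : nat) (w t : N.-tuple F) : F :=
  \sum_(i < N) tnth w i * tnth t i.

Definition ZpN (R : realType) (p : nat) (C : padicComplex R p) (N : nat) :
    set (N.-tuple C) := [set t | forall i, Zp C (tnth t i)].
Arguments ZpN {R p} C N _.

Definition Lambda (R : realType) (p : nat) (C : padicComplex R p) (N : nat)
    (w : N.-tuple C) : set C := dotp w @` ZpN C N.

(** Graph of the partial function s |-> zeta_{p,E,N}(s, x; w). *)
Definition is_zeta (R : realType) (p : nat) (C : padicComplex R p)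
    (iota : {rmorphism algC -> C}) (N : nat) (x : C) (w : N.-tuple C)
    (s z : C) : Prop :=
  ~ Lambda w x /\
  exists f : N.-tuple C -> C,
    (forall t, ZpN C N t -> is_powp (angle iota (x + dotp w t)) (1 - s) (f t)) /\
    is_fermionicN f z.

(** ** Euler polynomials of higher order *)

(** Formal power series as coefficient sequences. *)
Definition fps_mul (F : fieldType) (a b : nat -> F) : nat -> F :=
  fun n => \sum_(i < n.+1) a i * b (n - i)%N.

Definition fps_one (F : fieldType) : nat -> F := fun n => (n == 0%N)%:R.

(** First n coefficients of 1/a, solving a * b = 1 degree by degree. *)
Fixpoint fps_inv_seq (F : fieldType) (a : nat -> F) (n : nat) : seq F :=
  if n is m.+1 then
    let b := fps_inv_seq a m in
    rcons b (((m == 0%N)%:R - \sum_(i < m) b`_i * a (m - i)%N) / a 0%N)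
  else [::].

Definition fps_inv (F : fieldType) (a : nat -> F) : nat -> F :=
  fun n => (fps_inv_seq a n.+1)`_n.

Definition fps_exp (F : fieldType) (c : F) : nat -> F :=
  fun n => c ^+ n / (n`!)%:R.

Lemma size_fps_inv_seq (F : fieldType) (a : nat -> F) n :
  size (fps_inv_seq a n) = n.
Proof. by elim: n => //= n IHn; rewrite size_rcons IHn. Qed.

Lemma nth_fps_inv_seq (F : fieldType) (a : nat -> F) n i :
  (i < n)%N -> (fps_inv_seq a n)`_i = fps_inv a i.
Proof.
elim: n => // n IHn; rewrite ltnS leq_eqVlt => /orP[/eqP-> //|lt_in].
by rewrite /= nth_rcons size_fps_inv_seq lt_in IHn.
Qed.

Lemma fps_mulVf (F : fieldType) (a : nat -> F) :
  a 0%N != 0 -> fps_mul (fps_inv a) a = fps_one F.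
Proof.
move=> a0; apply/funext => n; rewrite /fps_mul big_ord_recr /= subnn.
rewrite {2}/fps_inv /= nth_rcons size_fps_inv_seq ltnn eqxx divfK //.
under [X in _ - X]eq_bigr => i _ do rewrite nth_fps_inv_seq //.
by rewrite addrC subrK.
Qed.

(** E_{N,n}(x; w): n! times the coefficient of t^n in
    2^N e^{xt} / prod_j (e^{w_j t} + 1). *)
Definition eulerp (F : fieldType) (N : nat) (w : N.-tuple F) (n : nat)
    (x : F) : F :=
  (n`!)%:R *
  fps_mul (fun k => 2 ^+ N * fps_exp x k)
    (fps_inv (\big[@fps_mul F/fps_one F]_(j < N)
                (fun k => fps_exp (tnth w j) k + fps_one F k))) n.

(** Graph of s |-> <x>^{1-s} sum_j binom(1-s,j) E_{N,j}(0; w) x^{-j}. *)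
Definition is_expansion (R : realType) (p : nat) (C : padicComplex R p)
    (iota : {rmorphism algC -> C}) (N : nat) (x : C) (w : N.-tuple C)
    (s z : C) : Prop :=
  exists b c : C,
    [/\ is_powp (angle iota x) (1 - s) b,
        is_sump (fun j => binomp (1 - s) j * eulerp w j 0 * x ^- j) c
      & z = b * c].

(** Both sides are defined and equal on the disc |s| < r, and the common
    function is analytic there. *)
Definition zeta_identity (R : realType) (p : nat) (C : padicComplex R p)
    (iota : {rmorphism algC -> C}) (N : nat) (x : C) (w : N.-tuple C)
    (r : R) : Prop :=
  exists F : C -> C,
    analytic_disc F r /\
    forall s, absp s < r ->
      is_zeta iota x w s (F s) /\ is_expansion iota x w s (F s).

Definition normp (R : realType) (p : nat) (C : padicComplex R p) (N : nat)
    (w : N.-tuple C) : R := \big[Num.max/0]_(i < N) absp (tnth w i).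

(** ** Finite extensions of Q_p inside C_p *)

Definition finite_extension (R : realType) (p : nat) (C : padicComplex R p)
    (K : set C) : Prop :=
  [/\ divring_closed (mem K), Qp C `<=` K &
      exists b : seq C, forall y, K y ->
        exists c : nat -> C,
          (forall i, Qp C (c i)) /\ y = \sum_(i < size b) c i * b`_i].

Definition integers (R : realType) (p : nat) (C : padicComplex R p)
    (K : set C) : set C := [set y | K y /\ absp y <= 1].

Definition maxideal (R : realType) (p : nat) (C : padicComplex R p)
    (K : set C) : set C := [set y | K y /\ absp y < 1].

Definition principal (R : realType) (p : nat) (C : padicComplex R p)
    (K : set C) (a : C) : set C := [set a * y | y in integers K].

Definition uniformizer (R : realType) (p : nat) (C : padicComplex R p)
    (K : set C) (pi : C) : Prop :=
  integers K pi /\ principal K pi = maxideal K.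

(** p O_K = m_K^e *)
Definition ramification_index (R : realType) (p : nat) (C : padicComplex R p)
    (K : set C) (e : nat) : Prop :=
  exists2 pi, uniformizer K pi & principal K p%:R = principal K (pi ^+ e).

(* Main.v *)
(* Write [y = <x>] and [a t = (w . t) / x], so that [<x + w . t> = y (1 + a t)]
   with [|y - 1|] and [|a t|] bounded by some [del < 1].  Telescoping
   [E_N(c) + E_N(c + w_1) = 2 E_(N-1)(c)] shows that the fermionic integral of
   [(c + w . t)^n] is [E_(N,n)(c; w)].  Integrating the binomial series of
   [(y (1 + a t))^(1-s)] term by term then gives the zeta function as a series
   [sum_n binom(1-s, n) J_n] with [|J_n| <= del^n], and the two factors of the
   expansion have the same shape.  Such series are power series in [s] where the
   Gauss norms of the polynomials [binom(1-s, n)] grow slower than [del^-n]: for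
   every [del < 1] on a small disc, and for [del = |pi|] on the disc
   [|s| < |pi|^-1 p^(-1/(p-1))].  At [1 - s = m] a natural number both sides
   are the integral of [(y (1 + a t))^m]; since the points [s = - p^i] accumulate
   at [0], the identity theorem for power series concludes. *)

Require Import Defs.
From HB Require Import structures.
From mathcomp Require Import all_boot all_order all_algebra all_field.
From mathcomp Require Import boolp classical_sets functions reals topology.
From mathcomp Require Import normedtype sequences exp.
From mathcomp Require Import zify ring lra.

Set Implicit Arguments.
Unset Strict Implicit.
Unset Printing Implicit Defensive.

Import Order.TTheory GRing.Theory Num.Theory.
Import numFieldNormedType.Exports.

Local Open Scope classical_set_scope.
Local Open Scope ring_scope.

(** * Null sequences *)

Section Vanishing.
Variable R : realType.
Implicit Types (e f : nat -> R) (b c : R).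

(** For general s, splitting (y (1 + a))^(1-s) into y^(1-s) (1 + a)^(1-s) would ask for a
    rearrangement of double binomial series; at natural exponents it is a ring identity, and
    analyticity in s carries it to the whole disc. This is why all estimates go through one number
    del, which alone decides the radius. The constant p^(-1/(p-1)) enters through |n!| >=
    p^(-n/(p-1)): if |s| <= M with M >= 1, the n-th term is at most (M del p^(1/(p-1)))^n. For del
    >= p^(-1/(p-1)) this estimate is useless even near s = 0; there the factors 1 - i of the
    numerator have to be played off against n!. The other obstacle is that [vp] and [hatp] are
    choices. Their defining properties rest on two facts about C_p, namely that the value group is
    p^Q and that every unit is congruent to a root of unity of order prime to p. Both are drawn from
    the density of the elements algebraic over Q_p. *)

Definition vanishing e :=
  forall d : R, 0 < d -> exists n0, forall n, (n0 <= n)%N -> e n < d.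

Lemma vanishing_le e f n0 :
  (forall n, (n0 <= n)%N -> e n <= f n) -> vanishing f -> vanishing e.
Proof.
move=> le_ef f0 d d_gt0; have [n1 n1P] := f0 d d_gt0.
exists (maxn n0 n1) => n; rewrite geq_max => /andP[le0 le1].
exact: le_lt_trans (le_ef n le0) (n1P n le1).
Qed.

Lemma vanishingP e : (forall n, 0 <= e n) -> vanishing e <-> e n @[n --> \oo] --> (0 : R).
Proof.
move=> e_ge0; split=> [e0|/cvgr0Pnorm_lt e0 d d_gt0].
  apply/cvgr0Pnorm_lt => d d_gt0; have [n0 n0P] := e0 d d_gt0.
  by exists n0 => // n /= le_n; rewrite ger0_norm // n0P.
have [n0 _ n0P] := e0 d d_gt0; exists n0 => n le_n.
by have /= := n0P n le_n; rewrite ger0_norm.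
Qed.

Lemma vanishing_geom c : 0 <= c < 1 -> vanishing (fun n => c ^+ n).
Proof.
move=> /andP[c_ge0 c_lt1]; apply/vanishingP => [n|]; first exact: exprn_ge0.
by apply: cvg_expr; rewrite ger0_norm.
Qed.

Lemma vanishingZ b e : 0 <= b -> vanishing e -> vanishing (fun n => b * e n).
Proof.
rewrite le_eqVlt => /orP[/eqP<- _ d d_gt0|b_gt0 e0 d d_gt0].
  by exists 0%N => n _; rewrite mul0r.
have [n0 n0P] := e0 (d / b) (divr_gt0 d_gt0 b_gt0).
by exists n0 => n /n0P; rewrite ltr_pdivlMr // mulrC.
Qed.

Lemma vanishing_bounded e : vanishing e -> exists2 b, 0 < b & forall n, e n <= b.
Proof.
move=> e0; have [n0 n0P] := e0 1 ltr01.
exists (1 + \sum_(i < n0) `|e i|) => [|n].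
  by rewrite ltr_pwDl // sumr_ge0.
have sum_ge0 : 0 <= \sum_(i < n0) `|e i| by rewrite sumr_ge0.
have [lt_n|le_n] := ltnP n n0; last first.
  by rewrite (le_trans (ltW (n0P n le_n))) // lerDl.
rewrite (bigD1 (Ordinal lt_n)) //= addrCA.
rewrite (le_trans (ler_norm _)) // lerDl addr_ge0 // sumr_ge0 //.
Qed.

End Vanishing.

(** * Ultrametric absolute values, limits and series *)

Section Absp.
Variables (R : realType) (p : nat) (C : padicComplex R p).
Implicit Types (y z l : C) (u v : nat -> C) (b : R).

Lemma absp0 : absp (0 : C) = 0.
Proof. exact/absp_eq0. Qed.

Lemma absp_eq0b y : (absp y == 0) = (y == 0).
Proof. by apply/eqP/eqP => /absp_eq0. Qed.

Lemma absp_gt0 y : (0 < absp y) = (y != 0).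
Proof. by rewrite lt_neqAle absp_ge0 andbT eq_sym absp_eq0b. Qed.

Lemma absp1 : absp (1 : C) = 1.
Proof.
have n0 : absp (1 : C) != 0 by rewrite absp_eq0b oner_eq0.
by apply: (mulfI n0); rewrite -abspM !mulr1.
Qed.

Lemma abspX y n : absp (y ^+ n) = absp y ^+ n.
Proof. by elim: n => [|n IHn]; rewrite ?expr0 ?absp1 // !exprS abspM IHn. Qed.

Lemma abspN1 : absp (- 1 : C) = 1.
Proof.
apply/eqP; rewrite -(@eqrXn2 _ 2) ?ler01 ?absp_ge0 //.
by rewrite -abspX sqrrN !expr1n absp1.
Qed.

Lemma abspN y : absp (- y) = absp y.
Proof. by rewrite -mulN1r abspM abspN1 mul1r. Qed.

Lemma abspB y z : absp (y - z) = absp (z - y).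
Proof. by rewrite -abspN opprB. Qed.

Lemma abspV y : absp y^-1 = (absp y)^-1.
Proof.
have [->|y0] := eqVneq y 0; first by rewrite invr0 absp0 invr0.
have ay0 : absp y != 0 by rewrite absp_eq0b.
by apply: (mulfI ay0); rewrite -abspM !divff // absp1.
Qed.

Lemma absp_sign n : absp ((- 1) ^+ n : C) = 1.
Proof. by rewrite abspX abspN1 expr1n. Qed.

Lemma abspD_le y z b : absp y <= b -> absp z <= b -> absp (y + z) <= b.
Proof. by move=> yb zb; rewrite (le_trans (absp_ultra _ _)) // ge_max yb. Qed.

Lemma abspD_lt y z b : absp y < b -> absp z < b -> absp (y + z) < b.
Proof. by move=> yb zb; rewrite (le_lt_trans (absp_ultra _ _)) // gt_max yb. Qed.

Lemma abspB_lt y z b : absp y < b -> absp z < b -> absp (y - z) < b.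
Proof. by move=> yb zb; apply: abspD_lt; rewrite ?abspN. Qed.

Lemma absp_sum_le (I : Type) (r : seq I) (P : pred I) (F : I -> C) b :
  0 <= b -> (forall i, P i -> absp (F i) <= b) ->
  absp (\sum_(i <- r | P i) F i) <= b.
Proof.
move=> b_ge0 Fb; elim/big_ind: _ => //; first by rewrite absp0.
by move=> y z; apply: abspD_le.
Qed.

Lemma absp_sum_lt (I : Type) (r : seq I) (P : pred I) (F : I -> C) b :
  0 < b -> (forall i, P i -> absp (F i) < b) ->
  absp (\sum_(i <- r | P i) F i) < b.
Proof.
move=> b_gt0 Fb; elim/big_ind: _ => //; first by rewrite absp0.
by move=> y z; apply: abspD_lt.
Qed.

Lemma absp_prod (I : Type) (r : seq I) (P : pred I) (F : I -> C) :
  absp (\prod_(i <- r | P i) F i) = \prod_(i <- r | P i) absp (F i).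
Proof. by elim/big_rec2: _ => [|i y a _ <-]; rewrite ?absp1 ?abspM. Qed.

Lemma abspD_dom y z : absp z < absp y -> absp (y + z) = absp y.
Proof.
move=> lt_zy; apply/le_anti/andP; split; first by rewrite abspD_le // ltW.
rewrite leNgt; apply/negP => lt_s.
by have := abspB_lt lt_s lt_zy; rewrite addrK ltxx.
Qed.

(** The absolute value is locally constant away from 0; this transfers it between an element and its
    approximations. *)
Lemma absp_near y z b : absp (y - z) < b -> b <= absp y -> absp z = absp y.
Proof.
move=> lt_b le_b; have -> : z = y + (z - y) by rewrite addrC subrK.
by rewrite abspD_dom // abspB (lt_le_trans lt_b).
Qed.

Lemma absp_nat_le1 n : absp (n%:R : C) <= 1.
Proof.
elim: n => [|n IHn]; first by rewrite absp0 ler01.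
by rewrite -natr1 abspD_le // absp1.
Qed.

Lemma absp_int_le1 (m : int) : absp (m%:~R : C) <= 1.
Proof. by case: m => n; rewrite ?NegzE ?rmorphN ?abspN /= -pmulrn absp_nat_le1. Qed.

Lemma cvgpP u l : cvgp u l <-> vanishing (fun n => absp (u n - l)).
Proof. by rewrite vanishingP // => n; apply: absp_ge0. Qed.

Lemma cvgp_ext u v l : u =1 v -> cvgp u l -> cvgp v l.
Proof. by move=> /funext->. Qed.

Lemma cvgp_cst l : cvgp (fun=> l) l.
Proof. by apply/cvgpP => d d_gt0; exists 0%N => n _; rewrite subrr absp0. Qed.

Lemma cvgpD u v l m : cvgp u l -> cvgp v m -> cvgp (fun n => u n + v n) (l + m).
Proof.
move=> /cvgpP ul /cvgpP vm; apply/cvgpP => d d_gt0.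
have [n0 n0P] := ul d d_gt0; have [n1 n1P] := vm d d_gt0.
exists (maxn n0 n1) => n; rewrite geq_max => /andP[/n0P lt0 /n1P lt1].
by rewrite opprD addrACA abspD_lt.
Qed.

Lemma cvgpZ z u l : cvgp u l -> cvgp (fun n => z * u n) (z * l).
Proof.
move=> /cvgpP ul; apply/cvgpP.
under eq_fun => n do rewrite -mulrBr abspM.
exact: vanishingZ (absp_ge0 _) ul.
Qed.

Lemma cvgpB u v l m : cvgp u l -> cvgp v m -> cvgp (fun n => u n - v n) (l - m).
Proof.
move=> ul vm; have := cvgpD ul (cvgpZ (- 1) vm).
by rewrite mulN1r; under eq_fun => n do rewrite mulN1r.
Qed.

Lemma cvgpM u v l m : cvgp u l -> cvgp v m -> cvgp (fun n => u n * v n) (l * m).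
Proof.
move=> ul /cvgpP vm.
have uvB n : u n * v n = m * u n + u n * (v n - m) by ring.
under eq_fun => n do rewrite uvB.
rewrite -[l * m]addr0; apply: cvgpD; first by rewrite mulrC; apply: cvgpZ.
have /cvgpP := ul; move=> /vanishing_bounded[b b_gt0 bP].
have ub n : absp (u n) <= Num.max b (absp l).
  by rewrite -[u n](subrK l) (le_trans (absp_ultra _ _)) // le_max2 // bP.
apply/cvgpP/(@vanishing_le _ _ (fun n => Num.max b (absp l) * absp (v n - m)) 0).
  by move=> n _; rewrite subr0 abspM ler_wpM2r ?absp_ge0.
by apply: vanishingZ => //; rewrite le_max ltW.
Qed.

Lemma cvgp_sum (I : Type) (r : seq I) (F : I -> nat -> C) (L : I -> C) :
  (forall i, cvgp (F i) (L i)) ->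
  cvgp (fun n => \sum_(i <- r) F i n) (\sum_(i <- r) L i).
Proof.
move=> FL; elim: r => [|i r IHr].
  by rewrite big_nil; under eq_fun => n do rewrite big_nil; apply: cvgp_cst.
by rewrite big_cons; under eq_fun => n do rewrite big_cons; apply: cvgpD.
Qed.

Lemma cvgp_le_near u l b n0 :
  cvgp u l -> (forall n, (n0 <= n)%N -> absp (u n) <= b) -> absp l <= b.
Proof.
move=> /cvgpP ul ub; rewrite leNgt; apply/negP => lt_bl.
have b_ge0 : 0 <= b by apply: le_trans (absp_ge0 _) (ub n0 _).
have [n1 n1P] := ul _ (le_lt_trans b_ge0 lt_bl).
have := n1P (maxn n0 n1) (leq_maxr _ _); have := ub _ (leq_maxl n0 n1).
set y := u _ => yb yl.
have := @absp_near l y (absp l); rewrite abspB yl => /(_ isT (lexx _)) eq_y.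
by rewrite eq_y in yb; move: (lt_le_trans lt_bl yb); rewrite ltxx.
Qed.

Lemma cvgp_unique u l m : cvgp u l -> cvgp u m -> l = m.
Proof.
move=> ul um; apply/eqP; rewrite -subr_eq0 -absp_eq0b eq_le absp_ge0 andbT.
have := cvgpB ul um; under eq_fun => n do rewrite subrr.
by move=> /(@cvgp_le_near _ _ 0 0); apply=> n _; rewrite absp0.
Qed.

Lemma is_sump_ext u v l : u =1 v -> is_sump u l -> is_sump v l.
Proof. by move=> /funext->. Qed.

Lemma is_sump_unique u l m : is_sump u l -> is_sump u m -> l = m.
Proof. exact: cvgp_unique. Qed.

Lemma is_sumpZ z u l : is_sump u l -> is_sump (fun n => z * u n) (z * l).
Proof.
move=> /(cvgpZ z); apply: cvgp_ext => n; by rewrite mulr_sumr.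
Qed.

Lemma is_sumpB u v l m :
  is_sump u l -> is_sump v m -> is_sump (fun n => u n - v n) (l - m).
Proof. by move=> ul /(cvgpB ul); apply: cvgp_ext => n; rewrite sumrB. Qed.

Lemma is_sump_finite u m :
  (forall n, (m <= n)%N -> u n = 0) -> is_sump u (\sum_(i < m) u i).
Proof.
move=> u0; apply/cvgpP => d d_gt0; exists m => n le_mn.
rewrite -!(big_mkord xpredT) (big_cat_nat (leq0n _) le_mn) /= addrC addrK.
by rewrite big_nat_cond big1 ?absp0 // => i /andP[/andP[le_mi _] _]; rewrite u0.
Qed.

Lemma is_sump_vanishing u l : is_sump u l -> vanishing (fun n => absp (u n)).
Proof.
move=> /cvgpP ul d d_gt0; have [n0 n0P] := ul d d_gt0.
exists n0 => n le_n; have -> : u n =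
   (\sum_(i < n.+1) u i - l) - (\sum_(i < n) u i - l) by rewrite big_ord_recr /=; ring.
by rewrite abspB_lt // n0P // leqW.
Qed.

(** A block of consecutive terms is no larger than its largest term, so null terms already make the
    partial sums Cauchy. *)
Lemma sump_exists u : vanishing (fun n => absp (u n)) -> exists l, is_sump u l.
Proof.
move=> u0; apply: Cp_complete => e e_gt0; have [n0 n0P] := u0 e e_gt0.
have wlogP m n : (n0 <= m)%N -> (m <= n)%N ->
    absp (\sum_(i < n) u i - \sum_(i < m) u i) < e.
  move=> le_m le_mn; rewrite -!(big_mkord xpredT) (big_cat_nat (leq0n _) le_mn) /= addrC addrK.
  rewrite big_nat_cond absp_sum_lt // => i /andP[/andP[le_mi _] _].
  by rewrite n0P // (leq_trans le_m).
exists n0 => m n le_m le_n; have [le_mn|/ltnW le_nm] := leqP m n; last exact: wlogP.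
by rewrite abspB wlogP.
Qed.

Lemma is_sump_tail u l m b : 0 <= b -> is_sump u l ->
  (forall n, (m <= n)%N -> absp (u n) <= b) -> absp (l - \sum_(i < m) u i) <= b.
Proof.
move=> b_ge0 ul ub; have := cvgpB ul (cvgp_cst (\sum_(i < m) u i)).
move=> /(@cvgp_le_near _ _ b m); apply=> n le_mn.
rewrite -!(big_mkord xpredT) (big_cat_nat (leq0n _) le_mn) /= addrC addrK.
by rewrite big_nat_cond absp_sum_le // => i /andP[/andP[le_mi _] _]; rewrite ub.
Qed.

(* The first [K] columns of a triangular array lie above its first [K] rows, so
   that the two partial sums differ by terms of rows [n >= K] only. *)
Lemma triangular_sump (T : nat -> nat -> C) (c : nat -> C) :
  (forall n k, (n < k)%N -> T n k = 0) ->
  (forall d, 0 < d -> exists n0, forall n k, (n0 <= n)%N -> absp (T n k) < d) ->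
  (forall k, is_sump (T^~ k) (c k)) ->
  exists2 l, is_sump (fun n => \sum_(k < n.+1) T n k) l & is_sump c l.
Proof.
move=> T0 Te Tc.
have [l Tl] : exists l, is_sump (fun n => \sum_(k < n.+1) T n k) l.
  apply: sump_exists => d d_gt0; have [n0 n0P] := Te d d_gt0.
  by exists n0 => n le_n; apply: absp_sum_lt => // k _; apply: n0P.
exists l => //; rewrite -[l]add0r.
have diffE K : \sum_(k < K) c k = \sum_(k < K) (c k - \sum_(n < K) T n k) +
    \sum_(n < K) \sum_(k < n.+1) T n k.
  rewrite sumrB [X in _ - X + _]exchange_big /= -addrA -[LHS]addr0; congr (_ + _).
  apply/esym/eqP; rewrite addrC subr_eq0; apply/eqP/eq_bigr => n _.
  rewrite (big_ord_widen K (T n)) // [RHS](bigID (fun k : 'I_K => (k < n.+1)%N)) /=.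
  by rewrite [X in _ = _ + X]big1 ?addr0 // => k; rewrite -leqNgt => /T0.
apply: (@cvgp_ext (fun K => \sum_(k < K) (c k - \sum_(n < K) T n k) +
    \sum_(n < K) \sum_(k < n.+1) T n k)) => [K|]; first by rewrite -diffE.
apply: cvgpD => //; apply/cvgpP => d d_gt0.
(* Tails are bounded non-strictly; halving [d] restores the strict inequality. *)
have d2_gt0 : 0 < d / 2 by rewrite divr_gt0.
have [n0 n0P] := Te (d / 2) d2_gt0.
exists n0 => K le_K; rewrite subr0; apply: le_lt_trans (_ : d / 2 < d); last by lra.
apply: absp_sum_le => [|k _]; first exact: ltW.
apply: is_sump_tail (Tc k) _ => [|n le_n]; first exact: ltW.
by rewrite ltW // n0P // (leq_trans le_K).
Qed.

(** The Cauchy product is a triangular array: row n is the n-th convolution coefficient, and column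
    k is [v] shifted by k and multiplied by [u k]. The rows are uniformly small because for large n
    one of k and n - k is large, while the other factor stays bounded. *)
Lemma is_sump_mul u v l m :
  is_sump u l -> is_sump v m -> is_sump (fps_mul u v) (l * m).
Proof.
move=> ul vm.
have u0 := is_sump_vanishing ul; have v0 := is_sump_vanishing vm.
have [bu bu_gt0 buP] := vanishing_bounded u0.
have [bv bv_gt0 bvP] := vanishing_bounded v0.
pose T n k := if (k <= n)%N then u k * v (n - k)%N else 0.
have T0 n k : (n < k)%N -> T n k = 0 by move=> lt_nk; rewrite /T leqNgt lt_nk.
have Te d : 0 < d ->
    exists n0, forall n k, (n0 <= n)%N -> absp (T n k) < d.
  move=> d_gt0; have [n1 n1P] := u0 _ (divr_gt0 d_gt0 bv_gt0).
  have [n2 n2P] := v0 _ (divr_gt0 d_gt0 bu_gt0).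
  exists (n1 + n2)%N => n k le_n; rewrite /T; case: leqP => [le_kn|_]; last first.
    by rewrite absp0.
  rewrite abspM; have [le_k|lt_k] := leqP n1 k.
    apply: le_lt_trans (_ : absp (u k) * bv < d); first by rewrite ler_wpM2l ?absp_ge0.
    by rewrite -ltr_pdivlMr // n1P.
  apply: le_lt_trans (_ : bu * absp (v (n - k)%N) < d).
    by rewrite ler_wpM2r ?absp_ge0.
  by rewrite mulrC -ltr_pdivlMr // n2P //; lia.
have Tc k : is_sump (T^~ k) (u k * m).
  have : cvgp (fun n => \sum_(i < n) u k * v i) (u k * m) by apply: is_sumpZ.
  move=> /cvgpP vk; apply/cvgpP => d d_gt0; have [n0 n0P] := vk d d_gt0.
  exists (n0 + k)%N => n le_n.
  have le_kn : (k <= n)%N by apply: leq_trans le_n; apply: leq_addl.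
  have -> : \sum_(i < n) T i k = \sum_(i < n - k) u k * v i.
    rewrite -(big_mkord xpredT (T^~ k)) -(big_mkord xpredT (fun i => u k * v i)).
    rewrite (big_cat_nat (leq0n _) le_kn) /= big_nat_cond big1 ?add0r; last first.
      by move=> i /andP[/andP[_ lt_i] _]; rewrite T0.
    rewrite -{1}[k]add0n big_addn; apply: eq_bigr => i _.
    by rewrite /T leq_addl addnK.
  by rewrite n0P //; lia.
have [L sumL] := triangular_sump T0 Te Tc.
move=> sumL'; suff <- : L = l * m.
  apply: is_sump_ext sumL => n.
  by apply: eq_bigr => k _; rewrite /T -ltnS ltn_ord.
apply: is_sump_unique sumL' _.
rewrite [l * m]mulrC; apply: is_sump_ext (is_sumpZ m ul) => k; exact: mulrC.
Qed.

(** If c_k is the first nonzero coefficient, a zero at s_i forces |c_k s_i^k| to be at most the size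
    of the tail, which is O(|s_i|^(k+1)); this fails for s_i close to 0. *)
Lemma identity_theorem (c : nat -> C) (r : R) (s : nat -> C) :
  0 < r -> (forall z, absp z < r -> exists l, is_sump (fun k => c k * z ^+ k) l) ->
  (forall i, s i != 0) -> cvgp s 0 ->
  (forall i, absp (s i) < r -> is_sump (fun k => c k * s i ^+ k) 0) ->
  forall k, c k = 0.
Proof.
move=> r_gt0 c_cvg s_neq0 /cvgpP s0 cs0 k.
have {}s0 d : 0 < d -> exists n0, forall n, (n0 <= n)%N -> absp (s n) < d.
  by move=> /s0[n0 n0P]; exists n0 => n /n0P; rewrite subr0.
have [i0 i0P] := s0 r r_gt0; set rho := absp (s i0).
have rho_gt0 : 0 < rho by rewrite absp_gt0.
have [b b_gt0 bP] := vanishing_bounded (is_sump_vanishing (cs0 i0 (i0P _ (leqnn _)))).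
have {}bP n : absp (c n) * rho ^+ n <= b by rewrite -abspX -abspM bP.
elim/ltn_ind: k => k IHk; apply/eqP; rewrite -absp_eq0b eq_le absp_ge0 andbT.
rewrite leNgt; apply/negP => ck_gt0.
(* For |s| <= rho and n > k, |c_n s^n| = |c_n| rho^n (|s| / rho)^n <= B |s|^(k+1). *)
pose B := b / rho ^+ k.+1.
have B_gt0 : 0 < B by rewrite divr_gt0 ?exprn_gt0.
have mn_gt0 : 0 < Num.min (Num.min r rho) (absp (c k) / B).
  by rewrite !lt_min r_gt0 rho_gt0 divr_gt0.
have [i /(_ i (leqnn _))] := s0 _ mn_gt0.
rewrite !lt_min => /andP[/andP[lt_r lt_rho]]; rewrite ltr_pdivlMr // ltNge => /negP; apply.
set sg := absp (s i) in lt_r lt_rho *.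
have sg_gt0 : 0 < sg by rewrite absp_gt0.
suff : absp (c k) * sg ^+ k <= sg ^+ k.+1 * B.
  by rewrite exprSr -mulrA mulrC ler_pM2l ?exprn_gt0.
have -> : absp (c k) * sg ^+ k = absp (0 - \sum_(j < k.+1) c j * s i ^+ j).
  rewrite big_ord_recr big1 /= => [|j _]; last by rewrite IHk ?mul0r.
  by rewrite !add0r abspN abspM abspX.
apply: is_sump_tail (cs0 i lt_r) _ => [|n lt_kn].
  by rewrite mulr_ge0 ?exprn_ge0 // ltW.
rewrite abspM abspX -/sg mulrA ler_pdivlMr ?exprn_gt0 //.
apply: le_trans (_ : sg ^+ k.+1 * (absp (c n) * rho ^+ n) <= _); last first.
  by rewrite ler_pM2l ?exprn_gt0.
rewrite -(subnK lt_kn) !exprD subnK //.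
have -> : absp (c n) * (sg ^+ (n - k.+1) * sg ^+ k.+1) * rho ^+ k.+1 =
  sg ^+ k.+1 * (absp (c n) * (sg ^+ (n - k.+1) * rho ^+ k.+1)) by ring.
rewrite !ler_wpM2l ?ler_wpM2r ?absp_ge0 ?exprn_ge0 ?(ltW sg_gt0) ?(ltW rho_gt0) //.
by rewrite lerXn2r ?nnegrE // ltW.
Qed.

End Absp.

(** * Absolute values of natural numbers and factorials *)

Section AbspNat.
Variables (R : realType) (p : nat) (C : padicComplex R p).
Hypothesis p_prime : prime p.

Lemma pR_gt0 : 0 < p%:R :> R.
Proof. by rewrite ltr0n prime_gt0. Qed.

Lemma pRV_lt1 : p%:R^-1 < 1 :> R.
Proof. by rewrite invf_lt1 ?pR_gt0 // ltr1n prime_gt1. Qed.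

Lemma absp_pX n : absp (p%:R ^+ n : C) = p%:R^-1 ^+ n.
Proof. by rewrite abspX absp_p. Qed.

(** By Bezout, |n| < 1 would write 1 as a difference of two elements of absolute value below 1. *)
Lemma absp_coprime n : coprime p n -> absp (n%:R : C) = 1.
Proof.
move=> co_pn; apply/le_anti; rewrite absp_nat_le1 /= leNgt; apply/negP => lt1.
have n_gt0 : (0 < n)%N.
  by case: n co_pn {lt1} => //; rewrite /coprime gcdn0; case: p p_prime => [|[|]].
have [km kn eq_k _] := egcdnP p n_gt0.
move: eq_k; rewrite gcdnC (eqP co_pn) => eq_k.
have := absp1 C; have -> : (1 : C) = km%:R * n%:R - kn%:R * p%:R.
  by rewrite -!natrM eq_k natrD addrC addKr.
have lt_m m (z : C) : absp z < 1 -> absp (m%:R * z) < 1.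
  by move=> z1; rewrite abspM (le_lt_trans _ z1) // ler_piMl ?absp_ge0 ?absp_nat_le1.
move=> eq1; have := @abspB_lt _ _ C _ _ _ (lt_m km _ lt1) (lt_m kn p%:R _).
by rewrite eq1 ltxx absp_p pRV_lt1 => /(_ isT).
Qed.

Lemma absp_natE n : (0 < n)%N -> absp (n%:R : C) = p%:R^-1 ^+ logn p n.
Proof.
move=> n_gt0; have [m co_pm {1}->] := pfactor_coprime p_prime n_gt0.
by rewrite natrM abspM absp_coprime // mul1r natrX absp_pX.
Qed.

Lemma natCp_eq0 n : (n%:R == 0 :> C) = (n == 0%N).
Proof.
case: n => [|n]; first by rewrite mulr0n !eqxx.
by rewrite -absp_eq0b absp_natE // expf_eq0 invr_eq0 (gt_eqF pR_gt0) andbF.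
Qed.

Lemma factCp_neq0 n : (n`!)%:R != 0 :> C.
Proof. by rewrite natCp_eq0 -lt0n fact_gt0. Qed.

(** Legendre's formula, summed by induction on the number of terms: the surplus n %/ p^K in the
    invariant pays for the next term, since p (m %/ p) <= m. *)
Lemma logn_fact_le n : (p.-1 * logn p n`! <= n)%N.
Proof.
suff sumP K : (p.-1 * (\sum_(1 <= k < K.+1) n %/ p ^ k) + n %/ p ^ K <= n)%N.
  by rewrite logn_fact //; apply: leq_trans (sumP n); apply: leq_addr.
elim: K => [|K IHK]; first by rewrite big_geq // muln0 expn0 divn1.
rewrite big_nat_recr //=; apply: leq_trans IHK.
rewrite mulnDr -addnA leq_add2l -mulSnr (ltn_predK (prime_gt1 p_prime)).
by rewrite expnSr divnMA mulnC leq_trunc_div.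
Qed.

(** The radius of convergence of the p-adic exponential; its powers bound |n!| from below. *)
Definition pth : R := p%:R `^ (- (p.-1)%:R^-1).

Lemma pth_gt0 : 0 < pth.
Proof. by rewrite powR_gt0 ?pR_gt0. Qed.

Lemma pthX : pth ^+ p.-1 = p%:R^-1.
Proof.
have p1_neq0 : (p.-1)%:R != 0 :> R by rewrite pnatr_eq0 -lt0n -ltnS prednK ?prime_gt0 ?prime_gt1.
by rewrite -powR_mulrn ?powR_ge0 // -powRrM mulNr mulVf // powR_inv1 // ltW ?pR_gt0.
Qed.

Lemma pth_lt1 : pth < 1.
Proof.
rewrite ltNge; apply/negP => le1; have := exprn_ege1 p.-1 le1.
by rewrite pthX leNgt pRV_lt1.
Qed.

Lemma absp_fact_ge n : pth ^+ n <= absp ((n`!)%:R : C).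
Proof.
rewrite absp_natE ?fact_gt0 // -pthX -exprM.
by rewrite ler_wiXn2l ?logn_fact_le ?(ltW pth_gt0) ?(ltW pth_lt1).
Qed.

End AbspNat.

(** * Euler polynomials as fermionic integrals *)

Section FormalSeries.
Variable F : fieldType.
Implicit Types (a b c : nat -> F) (y z : F).

(** The n-th coefficient of a product sees only the coefficients up to n, so truncation lets power
    series inherit the ring laws of polynomials. *)
Lemma fps_mul_poly a b (P Q : {poly F}) n :
  (forall i, (i <= n)%N -> a i = P`_i) -> (forall i, (i <= n)%N -> b i = Q`_i) ->
  fps_mul a b n = (P * Q)`_n.
Proof.
move=> aP bQ; rewrite coefM; apply: eq_bigr => i _.
by rewrite aP ?bQ ?leq_subr // -ltnS.
Qed.

Let trunc a n := \poly_(i < n.+1) a i.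
Let truncE a n i : (i <= n)%N -> a i = (trunc a n)`_i.
Proof. by move=> le_i; rewrite coef_poly ltnS le_i. Qed.

Lemma fps_mulC a b : fps_mul a b = fps_mul b a.
Proof.
apply/funext => n; have := mulrC (trunc a n) (trunc b n).
move=> /(congr1 (fun P : {poly F} => P`_n)).
by rewrite -(@fps_mul_poly a b) -?(@fps_mul_poly b a) // => i; apply: truncE.
Qed.

Lemma fps_mulA a b c : fps_mul a (fps_mul b c) = fps_mul (fps_mul a b) c.
Proof.
apply/funext => n.
have mulE a' b' i : (i <= n)%N -> fps_mul a' b' i = (trunc a' n * trunc b' n)`_i.
  by move=> le_i; apply: fps_mul_poly => j le_j; apply: truncE; apply: leq_trans le_i.
rewrite (@fps_mul_poly a _ (trunc a n) (trunc b n * trunc c n)); first last.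
- by move=> i; apply: mulE.
- by move=> i; apply: truncE.
rewrite (@fps_mul_poly _ c (trunc a n * trunc b n) (trunc c n)) ?mulrA //.
- by move=> i; apply: mulE.
- by move=> i; apply: truncE.
Qed.

Lemma fps_mul1 a : fps_mul (fps_one F) a = a.
Proof.
apply/funext => n; rewrite /fps_mul big_ord_recl big1 ?addr0 ?subn0 /fps_one /=.
  by rewrite mul1r.
by move=> i _; rewrite mul0r.
Qed.

Lemma fps_mulDr a b c : fps_mul a (b \+ c) = fps_mul a b \+ fps_mul a c.
Proof.
by apply/funext => n; rewrite /fps_mul /= -big_split; apply: eq_bigr => i _; rewrite mulrDr.
Qed.

Lemma fps_inv_mul a b : a 0%N != 0 -> b 0%N != 0 ->
  fps_mul a (fps_inv (fps_mul a b)) = fps_inv b.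
Proof.
move=> a0 b0; have ab0 : fps_mul a b 0%N != 0 by rewrite /fps_mul big_ord1 mulf_neq0.
rewrite -[RHS]fps_mul1 -(fps_mulVf ab0) [fps_mul a b]lock fps_mulC -lock.
rewrite [in RHS]fps_mulA -fps_mulA [fps_mul b _]fps_mulC fps_mulVf //.
by rewrite [RHS]fps_mulC fps_mul1.
Qed.

Definition euler_denom (y : F) : nat -> F := fun k => fps_exp y k + fps_one F k.

Lemma euler_denom0 y : euler_denom y 0 = 2.
Proof. by rewrite /euler_denom /fps_exp /fps_one /= expr0 divr1. Qed.

Hypothesis natF_eq0 : forall n, (n%:R == 0 :> F) = (n == 0%N).

Lemma fps_expD y z : fps_exp (y + z) = fps_mul (fps_exp y) (fps_exp z).
Proof.
apply/funext => n; rewrite /fps_mul /fps_exp exprDn mulr_suml.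
rewrite (reindex_inj rev_ord_inj) /=; apply: eq_bigr => i _.
have le_i : (i <= n)%N by rewrite -ltnS.
rewrite subSS subKn // bin_sub // -mulr_natl -!mulrA [_ / _]mulrC.
have fact0 k : (k`!)%:R != 0 :> F by rewrite natF_eq0 -lt0n fact_gt0.
have := congr1 (fun k => k%:R : F) (bin_fact le_i); rewrite !natrM => <-.
have := fact0 n; rewrite -(bin_fact le_i) !natrM !mulf_eq0 !negb_or => /and3P[bin0 _ _].
by field; rewrite !fact0 bin0.
Qed.

Let two_neq0 : 2 != 0 :> F. Proof. by rewrite natF_eq0. Qed.

Lemma euler_denoms0 N (w : N.-tuple F) :
  (\big[@fps_mul F/fps_one F]_(j < N) euler_denom (tnth w j)) 0%N != 0.
Proof.
elim/big_rec: _ => [|i a _ a0]; first exact: oner_neq0.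
by rewrite /fps_mul big_ord1 /= mulf_neq0 // euler_denom0.
Qed.

Lemma eulerp0 (w : 0.-tuple F) n y : eulerp w n y = y ^+ n.
Proof.
rewrite /eulerp big_ord0.
have -> : fps_inv (fps_one F) = fps_one F.
  by rewrite -[LHS]fps_mul1 fps_mulC fps_mulVf // oner_neq0.
rewrite fps_mulC fps_mul1 expr0 mul1r mulrC divfK //.
by rewrite natF_eq0 -lt0n fact_gt0.
Qed.

(** On generating functions, e^(yt) + e^((y + w1)t) = e^(yt) (e^(w1 t) + 1) cancels one factor of
    the denominator, and one of the N + 1 factors 2 is left over. *)
Lemma eulerp_cons N (w1 : F) (w : N.-tuple F) n y :
  eulerp [tuple of w1 :: w] n y + eulerp [tuple of w1 :: w] n (y + w1) =
  2 * eulerp w n y.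
Proof.
rewrite /eulerp -mulrDr mulrCA; congr (_ * _).
rewrite big_ord_recl tnth0; under eq_bigr => i _ do rewrite tnthS.
rewrite -![fun k => fps_exp _ k + _]/(euler_denom _).
rewrite (eq_bigr (fun j => euler_denom (tnth w j))) //.
set D := \big[_/_]_(_ < N) _; have D0 : D 0%N != 0 by apply: euler_denoms0.
set I := fps_inv _.
have -> : fps_inv D = fps_mul (euler_denom w1) I.
  by rewrite fps_inv_mul // euler_denom0.
have mulZ a b k m : fps_mul (fun i => k * a i) b m = k * fps_mul a b m.
  by rewrite /fps_mul mulr_sumr; apply: eq_bigr => i _; rewrite mulrA.
rewrite !mulZ exprS -!mulrA -mulrDr; congr (_ * _); rewrite -mulrDr; congr (_ * _).
rewrite fps_mulA; have -> : euler_denom w1 = fps_exp w1 \+ fps_one F by [].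
rewrite fps_mulDr -fps_expD [fps_mul _ (fps_one F)]fps_mulC fps_mul1.
by rewrite ![fps_mul _ I]fps_mulC fps_mulDr /= addrC.
Qed.

Lemma eulerp_alternating_sum N (w1 : F) (w : N.-tuple F) n y M :
  2 * \sum_(a < M) eulerp w n (y + w1 * a%:R) * (-1) ^+ a =
  eulerp [tuple of w1 :: w] n y -
  (-1) ^+ M * eulerp [tuple of w1 :: w] n (y + w1 * M%:R).
Proof.
elim: M => [|M IHM]; first by rewrite big_ord0 mulr0 expr0 mul1r mulr0 addr0 subrr.
rewrite big_ord_recr /= mulrDr IHM mulrA -(eulerp_cons w1) exprS -natr1 mulrDr mulr1 addrA.
ring.
Qed.

End FormalSeries.

(** * Multiple fermionic integrals: evaluation, bounds and term-by-term integration *)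

Section Fermionic.
Variables (R : realType) (p : nat) (C : padicComplex R p).
Hypotheses (p_prime : prime p) (p_odd : odd p).

Lemma Zp_nat n : Defs.Zp C n%:R.
Proof.
split; last exact: absp_nat_le1.
by exists (fun=> n%:R); under eq_fun => k do rewrite ratr_nat; apply: cvgp_cst.
Qed.

Lemma ZpN_cons N t (ts : N.-tuple C) :
  Defs.Zp C t -> ZpN C N ts -> ZpN C N.+1 [tuple of t :: ts].
Proof.
move=> Zt Zts i; case: (unliftP ord0 i) => [j|] ->; first by rewrite tnthS; apply: Zts.
by rewrite tnth0.
Qed.

Lemma cvgp_pX : cvgp (fun m => (p ^ m)%:R : C) 0.
Proof.
apply/cvgpP; under eq_fun => m do rewrite subr0 natrX absp_pX.
by apply: vanishing_geom; rewrite invr_ge0 ler0n pRV_lt1.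
Qed.

Lemma cvgp_exp u (l : C) n : cvgp u l -> cvgp (fun m => u m ^+ n) (l ^+ n).
Proof.
move=> ul; elim: n => [|n IHn]; first by under eq_fun => m do rewrite expr0; apply: cvgp_cst.
by rewrite exprS; under eq_fun => m do rewrite exprS; apply: cvgpM.
Qed.

Lemma cvgp_eulerp N (w : N.-tuple C) n u (l : C) :
  cvgp u l -> cvgp (fun m => eulerp w n (u m)) (eulerp w n l).
Proof.
move=> ul; apply: cvgpZ; apply: cvgp_sum => i; rewrite mulrC.
under eq_fun => m do rewrite mulrC; apply: cvgpZ; apply: cvgpZ.
rewrite /fps_exp mulrC; under eq_fun => m do rewrite mulrC.
by apply: cvgpZ; apply: cvgp_exp.
Qed.

(** By induction the inner N integrals give [eulerp w n (y + w1 * t)], whose alternating sum over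
    the outer variable telescopes. *)
Lemma is_fermionicN_eulerp N (w : N.-tuple C) n (y : C) :
  is_fermionicN (fun t => (y + dotp w t) ^+ n) (eulerp w n y).
Proof.
have nat0 := natCp_eq0 C p_prime.
elim: N w y => [|N IHN] w y /=; first by rewrite eulerp0 // /dotp big_ord0 addr0.
case/tupleP: w => w1 w; exists (fun t => eulerp w n (y + w1 * t)) => [t _|].
  have -> : (fun ts : N.-tuple C => (y + dotp [tuple of w1 :: w] [tuple of t :: ts]) ^+ n) =
      (fun ts => (y + w1 * t + dotp w ts) ^+ n); last exact: IHN.
  apply/funext => ts; rewrite /dotp big_ord_recl !tnth0 addrA; congr ((_ + _) ^+ _).
  by apply: eq_bigr => i _; rewrite !tnthS.
rewrite /is_fermionic.
have two_neq0 : 2 != 0 :> C by rewrite nat0.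
pose E z := eulerp [tuple of w1 :: w] n z.
(* Since p^m is odd, the boundary term of the telescoped sum has sign +; as p^m tends to 0, the mean
   of the two values tends to E y. *)
apply: (@cvgp_ext _ _ _ (fun m => 2^-1 * (E y + E (y + w1 * (p ^ m)%:R)))).
  move=> m; apply: (mulfI two_neq0); rewrite eulerp_alternating_sum // mulVKf //.
  by rewrite -signr_odd oddX p_odd orbT expr1 mulN1r opprK.
have -> : eulerp [tuple of w1 :: w] n y = 2^-1 * (E y + E (y + w1 * 0)).
  by apply: (mulfI two_neq0); rewrite mulVKf // mulr0 addr0 mulr_natl mulr2n.
apply: cvgpZ; apply: cvgpD; first exact: cvgp_cst.
apply: cvgp_eulerp; apply: cvgpD; first exact: cvgp_cst.
exact: cvgpZ cvgp_pX.
Qed.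

(** The outer sums sample the inner integrals at natural numbers only, and these lie in Z_p, where
    the inner integrals are determined by induction. *)
Lemma is_fermionicN_unique N (f : N.-tuple C -> C) l m :
  is_fermionicN f l -> is_fermionicN f m -> l = m.
Proof.
elim: N f l m => [|N IHN] f l m /=; first by move=> -> ->.
move=> [g gP gl] [h hP hm]; apply: (cvgp_unique gl).
apply: cvgp_ext hm => k; apply: eq_bigr => a _; congr (_ * _).
by apply: IHN (hP _ _) (gP _ _); apply: Zp_nat.
Qed.

Lemma is_fermionicNZ N (f : N.-tuple C -> C) z l :
  is_fermionicN f l -> is_fermionicN (fun t => z * f t) (z * l).
Proof.
elim: N f l => [|N IHN] f l /=; first by move=> ->.
move=> [g gP gl]; exists (fun t => z * g t) => [t /gP/IHN //|].
apply: cvgp_ext (cvgpZ z gl) => k; rewrite mulr_sumr.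
by apply: eq_bigr => a _; rewrite mulrA.
Qed.

(** The weights are signs, of absolute value 1, so the ultrametric inequality bounds every
    approximating sum by the supremum of the integrand, whatever its length. *)
Lemma is_fermionicN_le N (f : N.-tuple C -> C) l b :
  (forall t, ZpN C N t -> absp (f t) <= b) -> is_fermionicN f l -> absp l <= b.
Proof.
elim: N f l => [|N IHN] f l /= fb; first by move=> ->; apply: fb; case.
move=> [g gP gl]; have gb a : absp (g a%:R) <= b.
  have Za := Zp_nat a; apply: IHN (gP _ Za) => ts Zts; exact/fb/ZpN_cons.
apply: (@cvgp_le_near _ _ _ _ _ _ 0 gl) => m _; apply: absp_sum_le => [|a _].
  exact: le_trans (absp_ge0 _) (gb 0%N).
by rewrite abspM absp_sign mulr1.
Qed.

(** Domination by [e], uniform in t, allows sum and integral to be exchanged; it passes to the inner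
    integrals, so that induction on N applies. *)
Lemma is_fermionicN_sum N (F : nat -> N.-tuple C -> C) (I : nat -> C) f (e : nat -> R) :
  vanishing e -> (forall n t, ZpN C N t -> absp (F n t) <= e n) ->
  (forall n, is_fermionicN (F n) (I n)) ->
  (forall t, ZpN C N t -> is_sump (F^~ t) (f t)) ->
  exists2 l, is_sump I l & is_fermionicN f l.
Proof.
move=> e0; elim: N F I f => [|N IHN] F I f Fe FI Ff.
  have Z0 : ZpN C 0 [tuple] by case.
  have IE : I = F^~ [tuple] by apply/funext.
  by exists (f [tuple]); rewrite ?IE //; apply: Ff.
have /choice[g gP] : forall n, exists g : C -> C, (forall t, Defs.Zp C t ->
    is_fermionicN (fun ts : N.-tuple C => F n [tuple of t :: ts]) (g t)) /\
    is_fermionic g (I n) by move=> n; have [g gP gI] := FI n; exists g.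
have g_le n t : Defs.Zp C t -> absp (g n t) <= e n.
  move=> Zt; apply: is_fermionicN_le ((gP n).1 t Zt) => ts Zts.
  by apply: Fe; apply: ZpN_cons.
have /choice[G GP] : forall t, exists l, Defs.Zp C t -> is_sump (g^~ t) l /\
    is_fermionicN (fun ts : N.-tuple C => f [tuple of t :: ts]) l.
  (* The value 0 outside Z_p is a filler. *)
  move=> t; have [Zt|nZt] := pselect (Defs.Zp C t); last by exists 0.
  have [|n|ts Zts|l] := IHN (fun n ts => F n [tuple of t :: ts]) (g^~ t)
    (fun ts => f [tuple of t :: ts]); last by exists l.
  - by move=> n ts Zts; apply: Fe; apply: ZpN_cons.
  - by apply: (gP n).1.
  - by apply: Ff; apply: ZpN_cons.
have S_le (h : C -> C) b m : 0 <= b -> (forall a, absp (h a%:R) <= b) ->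
    absp (\sum_(a < p ^ m) h a%:R * (-1) ^+ a) <= b.
  by move=> b_ge0 hb; apply: absp_sum_le => // a _; rewrite abspM absp_sign mulr1.
have Ie n : absp (I n) <= e n by apply: is_fermionicN_le (FI n) => t; apply: Fe.
have [l Il] : exists l, is_sump I l.
  by apply: sump_exists; apply: (@vanishing_le _ _ e 0).
exists l => //=; exists G => [t /GP[] //|].
apply/cvgpP => d d_gt0; have d2_gt0 : 0 < d / 2 by rewrite divr_gt0.
have [n0 n0P] := e0 _ d2_gt0.
have tail n : (n0 <= n)%N -> e n <= d / 2 by move/n0P/ltW.
have /cvgpP : cvgp (fun m => \sum_(n < n0) \sum_(a < p ^ m) g n a%:R * (-1) ^+ a)
    (\sum_(n < n0) I n) by apply: cvgp_sum => n; apply: (gP n).2.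
move=> /(_ _ d_gt0)[m0 m0P]; exists m0 => m le_m.
set S := \sum_(a < _) _.
(* Three errors: the tail of the integrand, small uniformly in m; the first n0 integrals, handled by
   m0; the tail of the series of integrals. *)
have -> : S - l = (S - \sum_(n < n0) \sum_(a < p ^ m) g n a%:R * (-1) ^+ a) +
    (\sum_(n < n0) \sum_(a < p ^ m) g n a%:R * (-1) ^+ a - \sum_(n < n0) I n) -
    (l - \sum_(n < n0) I n) by ring.
have lt_d2 : d / 2 < d by lra.
apply: abspB_lt; first apply: abspD_lt.
- apply: le_lt_trans lt_d2.
  rewrite exchange_big /= -sumrB.
  under eq_bigr => a _ do rewrite -mulr_suml -mulrBl.
  apply: (S_le (fun t => G t - \sum_(n < n0) g n t)) => [|a]; first exact: ltW.
  apply: is_sump_tail (GP _ (Zp_nat a)).1 _ => [|n /tail]; first exact: ltW.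
  exact/le_trans/g_le/Zp_nat.
- exact: m0P.
- apply: le_lt_trans lt_d2; apply: is_sump_tail Il _ => [|n /tail]; first exact: ltW.
  exact/le_trans/Ie.
Qed.

End Fermionic.

(** * The value group and the residue field *)

Section ValueGroup.
Variables (R : realType) (p : nat) (C : padicComplex R p).
Hypothesis p_prime : prime p.
Implicit Types y z u : C.

Lemma absp_exprz y (m : int) : absp (y ^ m) = absp y ^ m.
Proof. by case: m => n; rewrite ?NegzE -?exprnN -?exprnP ?abspV abspX. Qed.

Lemma absp_intE (m : int) : m != 0 -> absp (m%:~R : C) = p%:R ^- logn p `|m|%N.
Proof.
move=> m0; rewrite -exprVn -(absp_natE C) ?absz_gt0 //.
by case: m m0 => n _; rewrite ?NegzE ?rmorphN ?abspN //= -pmulrn.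
Qed.

Lemma absp_ratrE (q : rat) : q != 0 -> exists m : int, absp (ratr q : C) = p%:R ^ m.
Proof.
move=> q0; rewrite /ratr abspM abspV !absp_intE ?numq_eq0 ?denq_neq0 //.
exists (- (logn p `|numq q|)%:Z + (logn p `|denq q|)%:Z).
by rewrite expfzDr ?gt_eqF ?pR_gt0 // exprnN invrK exprnP.
Qed.

Lemma Qp_approx y e : Qp C y -> 0 < e -> exists q : rat, absp (y - ratr q) < e.
Proof.
move=> [q /cvgpP qy] e_gt0; have [n0 /(_ n0 (leqnn _)) lt_e] := qy e e_gt0.
by exists (q n0); rewrite abspB.
Qed.

Lemma Qp_absp y : Qp C y -> y != 0 -> exists m : int, absp y = p%:R ^ m.
Proof.
move=> Qy y0; have [|q lt_q] := Qp_approx Qy (_ : 0 < absp y); first by rewrite absp_gt0.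
have eq_q := absp_near lt_q (lexx _); rewrite -eq_q; apply: absp_ratrE.
apply/eqP => q0; move: y0; rewrite -absp_gt0 -eq_q q0 /ratr mul0r absp0 ltxx //.
Qed.

Lemma ord_argmax n (f : 'I_n.+1 -> R) : exists i, forall j, f j <= f i.
Proof.
by case: (@Order.TotalTheory.arg_maxP _ _ _ ord0 xpredT f) => // i _ iP; exists i => j; apply: iP.
Qed.

(* Two terms of a vanishing sum must attain the maximal absolute value. *)
Lemma root_absp (q : {poly C}) y : q != 0 -> (forall i, Qp C q`_i) -> y != 0 -> root q y ->
  exists (k : nat) (m : int), (0 < k)%N /\ absp y ^+ k = p%:R ^ m.
Proof.
move=> q0 Qq y0 /rootP; rewrite horner_coef.
have := lead_coef_eq0 q; rewrite lead_coefE.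
case def_n: (size q) => [|n] /=; first by move: q0; rewrite -size_poly_eq0 def_n.
move=> lead0; have {}lead0 : q`_n != 0 by rewrite lead0.
pose f (i : 'I_n.+1) := absp (q`_i * y ^+ i).
have [i iP] := ord_argmax f; rewrite (bigD1 i) //= => sum0.
have fi_gt0 : 0 < f i.
  apply: lt_le_trans (iP ord_max); by rewrite absp_gt0 mulf_neq0 // expf_neq0.
have [j neq_ji eq_f] : exists2 j, j != i & f j = f i.
  apply: contrapT => no_j; move: sum0; apply/eqP; rewrite -absp_eq0b abspD_dom ?gt_eqF //.
  apply: absp_sum_lt => // j neq_ji; rewrite lt_neqAle iP andbT.
  by apply/eqP => eq_f; apply: no_j; exists j.
have coef0 k : 0 < f k -> q`_k != 0.
  by rewrite absp_gt0 mulf_eq0 negb_or => /andP[].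
have [mi eq_mi] := Qp_absp (Qq i) (coef0 i fi_gt0).
have [mj eq_mj] : exists m : int, absp q`_j = p%:R ^ m.
  by apply: Qp_absp (Qq j) (coef0 j _); rewrite eq_f.
have pn0 : p%:R != 0 :> R by rewrite gt_eqF ?pR_gt0.
have ay_gt0 : 0 < absp y by rewrite absp_gt0.
have eqf a b (ma mb : int) : (b < a)%N -> p%:R ^ ma * absp y ^+ a = p%:R ^ mb * absp y ^+ b ->
    exists (k : nat) (m : int), (0 < k)%N /\ absp y ^+ k = p%:R ^ m.
  move=> lt_ba; rewrite -(subnK (ltnW lt_ba)) exprD mulrA.
  move=> /(mulIf (lt0r_neq0 (exprn_gt0 _ ay_gt0))) eq_p.
  exists (a - b)%N, (- ma + mb); split; first by rewrite subn_gt0.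
  by rewrite expfzDr // -eq_p mulrA -expfzDr // addNr expr0z mul1r.
move: eq_f; rewrite /f !abspM !abspX eq_mi eq_mj => eq_f.
move: neq_ji; rewrite -val_eqE neq_ltn => /orP[] lt_ij.
  exact: eqf lt_ij (esym eq_f).
exact: eqf lt_ij eq_f.
Qed.

(** An algebraic z close to y has the same absolute value, and some positive power of |z| is an
    integral power of p. *)
Lemma absp_pratE y : y != 0 -> exists r : rat, absp y = p%:R `^ (- ratr r).
Proof.
move=> y0; have [|z [lt_z [q [q0 Qq qz]]]] := Cp_dense y (_ : 0 < absp y).
  by rewrite absp_gt0.
have eq_z := absp_near lt_z (lexx _).
have [|k [m [k_gt0 eq_k]]] := root_absp q0 Qq _ qz.
  by rewrite -absp_gt0 eq_z absp_gt0.
exists (- (m%:~R / k%:R)); rewrite rmorphN opprK fmorph_div rmorph_int rmorph_nat.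
apply/eqP; rewrite -(@eqrXn2 _ k) ?absp_ge0 ?powR_ge0 //.
rewrite -eq_z eq_k -powR_mulrn ?powR_ge0 // -powRrM divfK ?pnatr_eq0 -?lt0n //.
by rewrite powR_intmul.
Qed.

Lemma vpE y : y != 0 -> absp y = p%:R `^ (- ratr (vp y)).
Proof. by move=> /absp_pratE/(xgetPex 0). Qed.

(** The residue field of Q_p is F_p. The factor p^m serves to normalise coefficients in
    [algebraic_residue]; it is carried over to a rational approximation of y. *)
Lemma Zp_residue (m : int) y : Qp C y -> absp (p%:R ^ m * y) <= 1 ->
  exists n : int, absp (p%:R ^ m * y - n%:~R) < 1.
Proof.
move=> Qy y_le1; have pC0 : p%:R != 0 :> C by rewrite natCp_eq0 // gtn_eqF ?prime_gt0.
have apm0 : 0 < absp (p%:R ^ m : C) by rewrite absp_gt0 expfz_neq0.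
have [|q lt_q] := Qp_approx Qy (_ : 0 < (absp (p%:R ^ m : C))^-1); first by rewrite invr_gt0.
have {}lt_q : absp (p%:R ^ m * y - p%:R ^ m * ratr q) < 1.
  by rewrite -mulrBr abspM mulrC -ltr_pdivlMr // mul1r.
suff [n nP] : exists n : int, absp (p%:R ^ m * ratr q - n%:~R : C) < 1.
  by exists n; rewrite -[X in absp X](subrKA (p%:R ^ m * ratr q)) abspD_lt.
have {lt_q y_le1} q_le1 : absp (p%:R ^ m * ratr q : C) <= 1.
  rewrite -[X in absp X](subrK (p%:R ^ m * y)) abspD_le //.
  by rewrite abspB ltW.
have [a [b [b_gt0 eq_ab]]] : exists (a : int) (b : nat),
    (0 < b)%N /\ p%:R ^ m * ratr q = a%:~R / b%:R :> C.
  have denE : (denq q)%:~R = `|denq q|%N%:R :> C.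
    by rewrite pmulrn gez0_abs // ltW // denq_gt0.
  have den_gt0 : (0 < `|denq q|)%N by rewrite absz_gt0 denq_neq0.
  case: m {apm0 q_le1} => k.
    exists (numq q * (p ^ k)%:Z), `|denq q|%N; split=> //.
    by rewrite /ratr denE rmorphM /= -exprnP -pmulrn natrX mulrA [_ * (numq q)%:~R]mulrC.
  exists (numq q), (`|denq q| * p ^ k.+1)%N; split.
    by rewrite muln_gt0 den_gt0 expn_gt0 prime_gt0.
  by rewrite /ratr denE NegzE -exprnN natrM invfM natrX mulrC mulrA.
rewrite {}eq_ab {q m Qy apm0} in q_le1 *.
have [->|a0] := eqVneq a 0; first by exists 0; rewrite mul0r subrr absp0.
have [b' co_b def_b] := pfactor_coprime p_prime b_gt0; set l := logn p b in def_b.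
(* |a / b| <= 1 means that p divides a at least as often as b, so the p-part of the denominator
   cancels. *)
have dvd_a : (p ^ l %| `|a|)%N.
  rewrite pfactor_dvdn ?absz_gt0 //; move: q_le1.
  rewrite abspM abspV absp_intE // absp_natE // exprVn invrK mulrC.
  rewrite ler_pdivrMr ?exprn_gt0 ?pR_gt0 //.
  by rewrite mul1r ler_eXn2l // ltr1n prime_gt1.
have [a' def_a] : exists a' : int, a = a' * (p ^ l)%:Z.
  by exists (a %/ (p ^ l)%:Z)%Z; rewrite divzK // dvdzE absz_nat.
have pl0 : (p ^ l)%:R != 0 :> C by rewrite natrX expf_neq0.
have -> : a%:~R / b%:R = a'%:~R / b'%:R :> C.
  by rewrite def_b def_a rmorphM natrM /= -pmulrn -mulf_div divff // mulr1.
have b'_gt0 : (0 < b')%N by case: b' co_b def_b => // _ b0; move: b_gt0; rewrite b0.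
have [km kn eq_k _] := egcdnP p b'_gt0; rewrite gcdnC (eqP co_b) in eq_k.
(* [km] inverts b' modulo p: km b' = kn p + 1. *)
exists (a' * km%:Z); have b'0 : b'%:R != 0 :> C by rewrite natCp_eq0 // gtn_eqF.
have -> : a'%:~R / b'%:R - (a' * km)%:~R = a'%:~R / b'%:R * (- (kn%:R * p%:R)) :> C.
  rewrite rmorphM /= -pmulrn -natrM; apply: (mulIf b'0).
  rewrite mulrBl divfK // [RHS]mulrAC divfK //.
  by rewrite -mulrA -natrM eq_k natrD mulrDr mulr1 opprD addrCA subrr addr0 mulrN.
rewrite !abspM abspN abspV (absp_coprime _ p_prime co_b) invr1 mulr1 abspM absp_p.
apply: le_lt_trans (pRV_lt1 R p_prime); rewrite mulrA ler_piMl ?invr_ge0 //.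
by rewrite mulr_ile1 ?absp_ge0 ?absp_int_le1 ?absp_nat_le1.
Qed.

Lemma absp_int_horner_le1 (P : {poly int}) y : absp y <= 1 -> absp (map_poly intr P).[y] <= 1.
Proof.
move=> y1; rewrite horner_coef; apply: absp_sum_le => // i _.
rewrite coef_map /= abspM abspX.
by rewrite mulr_ile1 ?absp_ge0 ?exprn_ge0 ?exprn_ile1 ?absp_ge0 ?absp_int_le1.
Qed.

Lemma absp_int_horner_lt1 (P : {poly int}) y :
  map_poly (intr : int -> 'F_p) P = 0 -> absp y <= 1 -> absp (map_poly intr P).[y] < 1.
Proof.
move=> P0 y1; rewrite horner_coef; apply: absp_sum_lt => // i _.
rewrite coef_map /= abspM abspX.
apply: le_lt_trans (_ : absp ((P`_i)%:~R : C) < 1).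
  by rewrite ler_piMr ?absp_ge0 ?exprn_ile1 ?absp_ge0.
have [->|Pi0] := eqVneq P`_i 0; first by rewrite absp0.
rewrite absp_intE // invf_lt1 ?exprn_gt0 ?pR_gt0 // exprn_egt1 ?ltr1n ?prime_gt1 //.
rewrite -lt0n logn_gt0 mem_primes p_prime absz_gt0 Pi0 /=.
rewrite (dvdn_pcharf (pchar_Fp p_prime)).
have : (P`_i)%:~R = 0 :> 'F_p by have := coef_map (intr : int -> 'F_p) P i; rewrite P0 coef0.
by case: P`_i => n; rewrite ?NegzE ?rmorphN /= -pmulrn => /eqP; rewrite ?oppr_eq0.
Qed.

(** Pigeonhole: the remainders modulo P form a finite set, so two powers of X share one. *)
Lemma powers_mod_poly (F : finFieldType) (P : {poly F}) : P != 0 ->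
  exists i j, (i < j)%N /\ (P %| 'X^j - 'X^i)%R.
Proof.
move=> P0; pose d := (size P).-1.
pose f (i : 'I_(#|{: 'rV[F]_d}|).+1) := poly_rV ('X^i %% P) : 'rV[F]_d.
have size_mod (Q : {poly F}) : (size (Q %% P)%R <= d)%N.
  by rewrite -ltnS prednK ?ltn_modp // lt0n size_poly_eq0.
have [inj_f|] := boolP (injectiveb f).
  by have := leq_card _ (injectiveP _ inj_f); rewrite card_ord ltnn.
move=> /injectivePn[i [j neq_ij eq_f]].
have eq_mod : ('X^i %% P)%R = ('X^j %% P)%R.
  by rewrite -[LHS](poly_rV_K (size_mod _)) -[RHS](poly_rV_K (size_mod _)) -/(f i) eq_f.
have dvd_P (a b : nat) : ('X^a %% P)%R = ('X^b %% P)%R -> (P %| 'X^a - 'X^b)%R.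
  by move=> eq_ab; rewrite /dvdp modpD modpN eq_ab subrr.
by move: neq_ij; rewrite -val_eqE neq_ltn => /orP[] lt_ij; [exists i, j|exists j, i];
   split=> //; apply: dvd_P.
Qed.

(** The residue of y is algebraic over F_p, hence a root of unity. The residue field is never
    formed: q is scaled to maximal coefficient size 1 and replaced by an integer polynomial Z, and
    congruences modulo p become inequalities |.| < 1. *)
Lemma algebraic_residue y (q : {poly C}) : absp y = 1 -> q != 0 -> (forall i, Qp C q`_i) ->
  root q y -> exists2 m, (0 < m)%N & absp (y ^+ m - 1) < 1.
Proof.
move=> y1 q0 Qq /rootP; rewrite horner_coef.
case def_n: (size q) => [|n]; first by move: q0; rewrite -size_poly_eq0 def_n.
have [i0 i0P] := ord_argmax (fun i : 'I_n.+1 => absp q`_i).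
have qi0 : q`_i0 != 0.
  rewrite -absp_gt0; apply: lt_le_trans (i0P ord_max); rewrite absp_gt0 /=.
  by move: q0; rewrite -lead_coef_eq0 lead_coefE def_n.
have pC0 : p%:R != 0 :> C by rewrite natCp_eq0 // gtn_eqF ?prime_gt0.
have [m eq_m] := Qp_absp (Qq i0) qi0; move=> sum0.
have scale1 : absp (p%:R ^ m * q`_i0) = 1.
  rewrite abspM absp_exprz absp_p eq_m -exprzMl ?unitfE ?gt_eqF ?invr_gt0 ?pR_gt0 //.
  by rewrite mulVf ?gt_eqF ?pR_gt0 // exp1rz.
have scale_le i : (i < n.+1)%N -> absp (p%:R ^ m * q`_i) <= 1.
  by move=> lt_i; rewrite -scale1 !abspM ler_wpM2l ?absp_ge0 // (i0P (Ordinal lt_i)).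
have /choice[c cP] : forall i, exists c : int, (i < n.+1)%N -> absp (p%:R ^ m * q`_i - c%:~R) < 1.
  move=> i; have [lt_i|] := boolP (i < n.+1)%N; last by exists 0.
  by have [c cP] := Zp_residue (Qq i) (scale_le i lt_i); exists c.
pose Z : {poly int} := \poly_(i < n.+1) c i.
have Zy : absp (map_poly intr Z).[y] < 1.
  rewrite (@horner_coef_wide _ n.+1); last first.
    by rewrite (leq_trans (size_poly _ _)) // size_poly.
  move: (congr1 (fun z => p%:R ^ m * z) sum0); rewrite mulr0 mulr_sumr => sum0'.
  rewrite -[X in absp X]subr0 -[X in _ - X]sum0' -sumrB.
  apply: absp_sum_lt => // i _; rewrite coef_map coef_poly ltn_ord /= mulrA -mulrBl.
  by rewrite abspM abspX y1 expr1n mulr1 abspB cP.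
(* The coefficient at [i0], where the maximum is attained, is a unit and survives reduction. *)
have Z0 : map_poly (intr : int -> 'F_p) Z != 0.
  apply/eqP => Z0; have := @absp_int_horner_lt1 (c i0)%:P 1.
  rewrite !map_polyC hornerC absp1 lexx /=.
  have -> : absp ((c i0)%:~R : C) = 1.
    by rewrite -scale1; apply: absp_near (cP i0 (ltn_ord i0)) _; rewrite scale1.
  rewrite ltxx => H; suff: false by []; apply: H => //.
  have := congr1 (fun P : {poly 'F_p} => P`_i0) Z0.
  rewrite coef_map coef_poly ltn_ord coef0 /= => ->.
  by rewrite polyC0.
have [i [j [lt_ij /dvdpP[A eqA]]]] := powers_mod_poly Z0.
(* Lifting the cofactor to integers makes X^j - X^i - A' Z vanish modulo p, so it is small at y; as
   Z(y) is small, so is y^j - y^i. *)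
pose A' : {poly int} := map_poly (fun a : 'F_p => (a : nat)%:Z) A.
have A'E : map_poly (intr : int -> 'F_p) A' = A.
  apply/polyP => k; rewrite coef_map coef_map_id0 //= -pmulrn; exact: natr_Zp.
have D0 : map_poly (intr : int -> 'F_p) ('X^j - 'X^i - A' * Z) = 0.
  by rewrite !rmorphB rmorphM !rmorphXn /= !map_polyX A'E eqA subrr.
have y_le1 : absp y <= 1 by rewrite y1.
have := absp_int_horner_lt1 D0 y_le1.
rewrite !rmorphB rmorphM !rmorphXn /= !map_polyX !hornerE => lt_D.
have lt_ji : absp (y ^+ j - y ^+ i) < 1.
  rewrite -[X in absp X](subrK ((map_poly intr A').[y] * (map_poly intr Z).[y])) abspD_lt //.
  rewrite abspM; apply: le_lt_trans Zy; rewrite ler_piMl ?absp_ge0 //.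
  exact: absp_int_horner_le1.
exists (j - i)%N; first by rewrite subn_gt0.
move: lt_ji; rewrite -(subnK (ltnW lt_ij)) exprD -{2}[y ^+ i]mul1r -mulrBl.
by rewrite abspM abspX y1 expr1n mulr1 subnK // ltnW.
Qed.

(** Injectivity of Frobenius on the residue field: with d = y - 1, the intermediate binomial
    coefficients are divisible by p, so y^p - 1 is congruent to d^p. *)
Lemma absp_exp_p_near1 y : absp y <= 1 -> absp (y ^+ p - 1) < 1 -> absp (y - 1) < 1.
Proof.
move=> y1 yp; rewrite ltNge; apply/negP => d_ge1.
have d1 : absp (y - 1) = 1.
  by apply/le_anti; rewrite d_ge1 andbT abspD_le // abspN absp1.
move: yp; set d := y - 1 in d1 *; have -> : y = 1 + d by rewrite addrC subrK.
have binE n : (1 + d) ^+ n.+1 - 1 =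
    d ^+ n.+1 + \sum_(i < n) d ^+ i.+1 *+ 'C(n.+1, i.+1).
  rewrite exprDn big_ord_recl big_ord_recr /= /bump /= add1n.
  rewrite !expr1n bin0 binn expr0 !mul1r !mulr1n [LHS]addrC addKr addrC.
  by congr (_ + _); apply: eq_bigr => i _; rewrite expr1n mul1r.
have := binE p.-1; rewrite (prednK (prime_gt0 p_prime)) => -> lt1.
suff: absp (d ^+ p) < 1 by rewrite abspX d1 expr1n ltxx.
rewrite -[d ^+ p](addrK (\sum_(i < p.-1) d ^+ i.+1 *+ 'C(p, i.+1))).
rewrite abspB_lt //; apply: absp_sum_lt => // i _.
rewrite -mulr_natr abspM abspX d1 expr1n mul1r.
have /dvdnP[k ->] : (p %| 'C(p, i.+1))%N.
  by apply: prime_dvd_bin => //=; rewrite -ltn_predRL ltn_ord.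
rewrite natrM abspM absp_p; apply: le_lt_trans (pRV_lt1 R p_prime).
by rewrite ler_piMl ?invr_ge0 // absp_nat_le1.
Qed.

Lemma absp_exp_pX_near1 y k : absp y <= 1 -> absp (y ^+ (p ^ k) - 1) < 1 -> absp (y - 1) < 1.
Proof.
move=> y1; elim: k => [|k IHk]; first by rewrite expn0 expr1.
rewrite expnSr exprM => /absp_exp_p_near1 H; apply/IHk/H.
by rewrite abspX exprn_ile1 ?absp_ge0.
Qed.

Lemma absp_root_of_unity y n : (0 < n)%N -> y ^+ n = 1 -> absp y = 1.
Proof.
move=> n_gt0 yn; apply/eqP; rewrite -(@eqrXn2 _ n) ?absp_ge0 ?ler01 //.
by rewrite -abspX yn absp1 expr1n.
Qed.

(** Some power y^m of an algebraic approximation y of u is close to 1; removing the p-part of m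
    leaves y^n close to 1 with n prime to p. As y^n - 1 is the product of the y - w over the n-th
    roots of unity w, some factor is smaller than 1. *)
Lemma residue_root_of_unity u : absp u = 1 ->
  exists w : C, (exists n, n.-primitive_root w /\ coprime n p) /\ absp (u - w) < 1.
Proof.
move=> u1; have [y [lt_y [q [q0 Qq qy]]]] := Cp_dense u ltr01.
have y1 : absp y = 1 by rewrite -u1; apply: absp_near lt_y _; rewrite u1.
have [m m_gt0 ym] := algebraic_residue y1 q0 Qq qy.
have [n co_pn def_m] := pfactor_coprime p_prime m_gt0.
have n_gt0 : (0 < n)%N by case: n co_pn def_m => // _ m0; move: m_gt0; rewrite m0.
have yn : absp (y ^+ n - 1) < 1.
  apply: (@absp_exp_pX_near1 _ (logn p m)); first by rewrite abspX y1 expr1n.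
  by rewrite -exprM -def_m.
have [r def_r] := closed_field_poly_normal ('X^n - 1 : {poly C}).
have monic_X : 'X^n - 1 \is @monic C by rewrite monicXnsubC.
move: (def_r); rewrite (eqP monic_X) scale1r => {}def_r.
have [w w_r lt_w] : exists2 w, w \in r & absp (y - w) < 1.
  apply: contrapT => no_w; move: yn.
  have -> : y ^+ n - 1 = \prod_(z <- r) (y - z).
    have := congr1 (fun P => P.[y]) def_r; rewrite !hornerE horner_prod => ->.
    by apply: eq_bigr => z _; rewrite !hornerE.
  rewrite absp_prod ltNge big_seq; apply/negP; rewrite negbK.
  apply: (big_ind (fun a : R => 1 <= a)) => // [a b|w w_r]; first exact: mulr_ege1.
  by rewrite leNgt; apply/negP => lt_w; apply: no_w; exists w.
have wn : w ^+ n = 1.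
  apply/eqP; rewrite -subr_eq0; have : root ('X^n - 1) w by rewrite def_r root_prod_XsubC.
  by rewrite /root !hornerE.
have [k prim_k dvd_k] := prim_order_exists n_gt0 wn.
exists w; split.
  by exists k; split=> //; apply: coprime_dvdl dvd_k _; rewrite coprime_sym.
by rewrite -(subrKA y) abspD_lt.
Qed.

(** The cofactor 1 + y + ... + y^(k-1) is congruent to k, a unit. *)
Lemma absp_expr_sub1 y k : absp (y - 1) < 1 -> coprime p k -> absp (y ^+ k - 1) = absp (y - 1).
Proof.
move=> lt1 co_pk; rewrite subrX1 abspM.
have y1 : absp y = 1 by rewrite -(absp1 C); apply: absp_near (_ : _ < 1) _; rewrite ?absp1 // abspB.
have -> : \sum_(i < k) y ^+ i = k%:R + \sum_(i < k) (y ^+ i - 1).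
  by rewrite sumrB sumr_const card_ord addrC subrK.
suff lt_k : absp (\sum_(i < k) (y ^+ i - 1)) < absp (k%:R : C).
  by rewrite (abspD_dom lt_k) absp_coprime // mulr1.
rewrite absp_coprime //; apply: absp_sum_lt => // i _.
rewrite subrX1 abspM; apply: le_lt_trans lt1; rewrite ler_piMr ?absp_ge0 //.
by apply: absp_sum_le => // j _; rewrite abspX y1 expr1n.
Qed.

End ValueGroup.

(** * The projection <y> and its behaviour under small relative perturbations *)

Section Angle.
Variables (R : realType) (p : nat) (C : padicComplex R p).
Variable iota : {rmorphism algC -> C}.
Hypothesis p_prime : prime p.
Implicit Types y z : C.

Lemma prat_pow (r : rat) : prat p r ^+ `|denq r|%N = (p%:R : algC) ^ numq r.
Proof. by rewrite rootCK // absz_gt0 denq_neq0. Qed.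

Lemma pratN (r : rat) : prat p (- r) = (prat p r)^-1.
Proof.
rewrite /prat denqN numqN -invr_expz rootCV //.
by rewrite exprz_ge0.
Qed.

Lemma absp_iota_prat (r : rat) : absp (iota (prat p r)) = p%:R `^ (- ratr r).
Proof.
have d_gt0 : (0 < `|denq r|)%N by rewrite absz_gt0 denq_neq0.
apply/eqP; rewrite -(@eqrXn2 _ `|denq r|%N) ?absp_ge0 ?powR_ge0 //.
rewrite -abspX -rmorphXn prat_pow fmorphXz rmorph_nat absp_exprz absp_p.
rewrite -powR_mulrn ?powR_ge0 // -powRrM mulNr powRN.
have -> : ratr r * `|denq r|%N%:R = (numq r)%:~R :> R.
  rewrite pmulrn gez0_abs ?(ltW (denq_gt0 _)) // /ratr divfK //.
  by rewrite intr_eq0 denq_neq0.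
by rewrite powR_intmul // exprz_inv -invr_expz.
Qed.

Lemma angleE y : angle iota y = y / iota (prat p (vp y)) / hatp iota y.
Proof. by rewrite /angle pratN fmorphV [_ * y]mulrC. Qed.

Lemma hatpP y : y != 0 ->
  (exists n, n.-primitive_root (hatp iota y) /\ coprime n p) /\
  absp (y / iota (prat p (vp y)) - hatp iota y) < 1.
Proof.
move=> y0; apply: (@xgetPex _ 1 [set w : C |
    (exists n, n.-primitive_root w /\ coprime n p) /\
    absp (y / iota (prat p (vp y)) - w) < 1]).
apply: residue_root_of_unity => //.
by rewrite abspM abspV absp_iota_prat -vpE // divff // absp_eq0b.
Qed.

Lemma absp_hatp y : y != 0 -> absp (hatp iota y) = 1.
Proof.
move=> /hatpP[[n [prim_n _]] _].
exact: absp_root_of_unity (prim_order_gt0 prim_n) (prim_expr_order prim_n).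
Qed.

Lemma angle_near1 y : y != 0 -> absp (angle iota y - 1) < 1.
Proof.
move=> y0; have [_ lt1] := hatpP y0; have h1 := absp_hatp y0.
have h0 : hatp iota y != 0 by rewrite -absp_gt0 h1.
by rewrite angleE -[X in _ - X](divff h0) -mulrBl abspM abspV h1 invr1 mulr1.
Qed.

(** The factor 1 + z alters neither the absolute value nor the residue of the unit part, so the sets
    from which [vp] and [hatp] choose are the same, and with them the choices. *)
Lemma angleM1 y z : y != 0 -> absp z < 1 -> angle iota (y * (1 + z)) = angle iota y * (1 + z).
Proof.
move=> y0 z1; have z1' : absp (1 + z) = 1 by rewrite -(absp1 C) abspD_dom ?absp1.
have eq_vp : vp (y * (1 + z)) = vp y by rewrite /vp abspM z1' mulr1.
have eq_hat : hatp iota (y * (1 + z)) = hatp iota y.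
  rewrite /hatp eq_vp; congr xget; apply/funext => w; apply/propext => /=.
  set P := iota _; have yP : absp (y / P) = 1.
    by rewrite abspM abspV absp_iota_prat -vpE // divff // absp_eq0b.
  have diff : absp (y * (1 + z) / P - y / P) < 1.
    by rewrite mulrAC mulrDr mulr1 addrAC subrr add0r abspM yP mul1r.
  split=> -[? lt1]; split=> //.
    by rewrite -(subrKA (y * (1 + z) / P)) abspD_lt // abspB.
  by rewrite -(subrKA (y / P)) abspD_lt.
by rewrite !angleE eq_vp eq_hat [RHS]mulrAC [in RHS](mulrAC y).
Qed.

End Angle.

(** * Binomial series as analytic functions of the exponent *)

Section Binomial.
Variables (R : realType) (p : nat) (C : padicComplex R p).
Hypothesis p_prime : prime p.

(** The product of the Gauss norms of radius rho of the linear factors (1 - i) - X, divided by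
    |n!|. *)
Definition binom_bound (n : nat) (rho : R) : R :=
  (\prod_(i < n) Num.max rho (absp (1 - i%:R : C))) / absp ((n`!)%:R : C).

(** binom(1 - X, n): the indeterminate stands for s, the variable in which analyticity is
    claimed. *)
Definition binom_poly (n : nat) : {poly C} :=
  ((n`!)%:R)^-1 *: \prod_(i < n) ((1 - i%:R)%:P - 'X).

Lemma binom_polyE n s : (binom_poly n).[s] = binomp (1 - s) n.
Proof.
rewrite hornerZ horner_prod /binomp mulrC; congr (_ / _).
by apply: eq_bigr => i _; rewrite !hornerE; ring.
Qed.

Lemma size_binom_poly n : (size (binom_poly n) <= n.+1)%N.
Proof.
apply: leq_trans (size_scale_leq _ _) _.
elim: n => [|n IHn]; first by rewrite big_ord0 size_poly1.
rewrite big_ord_recr /=; apply: leq_trans (size_polyMleq _ _) _.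
rewrite -[n.+2]/(n.+3.-1) -!subn1 leq_sub2r // -addn2 leq_add //.
rewrite (leq_trans (size_polyD _ _)) // size_polyN size_polyX geq_max.
by rewrite (leq_trans (size_polyC_leq1 _)).
Qed.

(* The Gauss norm of radius [rho] of a product is bounded by the product of the
   Gauss norms. *)
Lemma coef_binom_poly_le n rho k :
  0 <= rho -> absp (binom_poly n)`_k * rho ^+ k <= binom_bound n rho.
Proof.
move=> rho_ge0; rewrite coefZ abspM abspV -mulrA.
rewrite /binom_bound [leRHS]mulrC ler_wpM2l ?invr_ge0 ?absp_ge0 //.
elim: n k => [|n IHn] k.
  rewrite !big_ord0 coef1; case: k => [|k]; first by rewrite absp1 expr0 mulr1.
  by rewrite absp0 mul0r.
rewrite !big_ord_recr /=; set P := \prod_(i < n) _; set B := \prod_(i < n) Num.max _ _ in IHn *.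
have B_ge0 : 0 <= B by apply: prodr_ge0 => i _; rewrite le_max rho_ge0.
set m := Num.max _ _; have m_ge0 : 0 <= m by rewrite le_max rho_ge0.
have -> : (P * ((1 - n%:R)%:P - 'X))`_k =
    (1 - n%:R) * P`_k - (if k is k'.+1 then P`_k' else 0).
  by rewrite mulrBr coefB mulrC coefCM coefMX; case: k.
have le_D (y z : C) b c : 0 <= c -> absp y * c <= b -> absp z * c <= b -> absp (y - z) * c <= b.
  move=> c_ge0 yb zb; apply: le_trans (_ : Num.max (absp y) (absp z) * c <= b).
    by rewrite ler_wpM2r // -(abspN z) absp_ultra.
  by rewrite maxr_pMl // ge_max yb zb.
apply: le_D; first exact: exprn_ge0.
  rewrite abspM -mulrA [B * _]mulrC ler_pM ?absp_ge0 ?mulr_ge0 ?absp_ge0 ?exprn_ge0 //.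
  by rewrite le_max lexx orbT.
case: k => [|k]; first by rewrite absp0 mul0r mulr_ge0.
rewrite exprSr mulrA ler_pM ?mulr_ge0 ?absp_ge0 ?exprn_ge0 //.
by rewrite le_max lexx.
Qed.

Lemma binom_bound_ge0 n rho : 0 <= rho -> 0 <= binom_bound n rho.
Proof.
move=> rho_ge0; rewrite divr_ge0 ?absp_ge0 // prodr_ge0 // => i _.
by rewrite le_max rho_ge0.
Qed.

Lemma absp_binomp_le n s : absp (binomp (1 - s) n : C) <= binom_bound n (absp s).
Proof.
rewrite -binom_polyE horner_coef; apply: absp_sum_le => [|i _].
  by rewrite binom_bound_ge0 ?absp_ge0.
by rewrite abspM abspX coef_binom_poly_le ?absp_ge0.
Qed.

(** The condition under which every series of binom(1-s, n) a_n with |a_n| <= del^n is analytic on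
    |s| < r. *)
Definition binom_summable (del r : R) :=
  forall rho, 0 <= rho < r -> vanishing (fun n => binom_bound n rho * del ^+ n).

(** Expanding each binom(1-s, n) in powers of s gives a triangular array, the degree being at most
    n; its column sums are the coefficients [c]. *)
Lemma binomp_series_analytic (a : nat -> C) del r :
  0 < r -> binom_summable del r -> (forall n, absp (a n) <= del ^+ n) ->
  exists c : nat -> C, forall s, absp s < r ->
    exists2 l, is_sump (fun n => binomp (1 - s) n * a n) l &
               is_sump (fun k => c k * s ^+ k) l.
Proof.
move=> r_gt0 sum_del a_le.
have coef_le n k rho : 0 <= rho ->
    absp ((binom_poly n)`_k * a n) * rho ^+ k <= binom_bound n rho * del ^+ n.
  move=> rho_ge0; rewrite abspM mulrAC ler_pM ?absp_ge0 ?mulr_ge0 ?exprn_ge0 ?absp_ge0 //.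
  exact: coef_binom_poly_le.
have /choice[c cP] : forall k, exists c, is_sump (fun n => (binom_poly n)`_k * a n) c.
  (* Any radius strictly between 0 and r would serve to bound the k-th column. *)
  move=> k; apply: sump_exists; have r2 : 0 < r / 2 by rewrite divr_gt0.
  have r2k : 0 < (r / 2) ^+ k by rewrite exprn_gt0.
  apply: (@vanishing_le _ _ (fun n => ((r / 2) ^+ k)^-1 *
    (binom_bound n (r / 2) * del ^+ n)) 0) => [n _|].
    by rewrite [leRHS]mulrC ler_pdivlMr // coef_le // ltW.
  apply: vanishingZ; first by rewrite invr_ge0 ltW.
  by apply: sum_del; rewrite (ltW r2) /=; lra.
exists c => s lt_s; pose T n k := (binom_poly n)`_k * a n * s ^+ k.
have [|||l l1 l2] := @triangular_sump _ _ C T (fun k => c k * s ^+ k).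
- move=> n k lt_nk; rewrite /T nth_default ?mul0r //.
  exact: leq_trans (size_binom_poly n) lt_nk.
- move=> d d_gt0; have [|n0 n0P] := sum_del (absp s) _ d d_gt0.
    by rewrite absp_ge0.
  exists n0 => n k /n0P; apply: le_lt_trans.
  by rewrite abspM abspX coef_le ?absp_ge0.
- move=> k; rewrite mulrC; apply: is_sump_ext (is_sumpZ (s ^+ k) (cP k)) => n.
  exact: mulrC.
exists l => //; apply: is_sump_ext l1 => n.
rewrite -binom_polyE (horner_coef_wide _ (size_binom_poly n)) mulr_suml.
by apply: eq_bigr => k _; rewrite /T mulrAC.
Qed.

Lemma binomp_nat m n : binomp (m%:R : C) n = 'C(m, n)%:R.
Proof.
rewrite /binomp; apply: (mulIf (factCp_neq0 C p_prime n)).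
rewrite divfK ?factCp_neq0 // -natrM bin_ffact.
elim: n => [|n IHn]; first by rewrite big_ord0 ffactn0.
rewrite big_ord_recr /= IHn ffactnSr natrM.
have [le_nm|lt_mn] := leqP n m; first by rewrite natrB.
by rewrite ffact_small ?mul0r.
Qed.

Lemma is_sump_binomial m (z : C) : is_sump (fun n => binomp (m%:R) n * z ^+ n) ((1 + z) ^+ m).
Proof.
have -> : (1 + z) ^+ m = \sum_(n < m.+1) binomp m%:R n * z ^+ n.
  rewrite exprDn; apply: eq_bigr => i _.
  by rewrite expr1n mul1r binomp_nat mulr_natl.
apply: is_sump_finite => n lt_mn; by rewrite binomp_nat bin_small ?mul0r.
Qed.

(** With M = max(rho, 1), numerators are at most M^n and |n!| >= [pth]^n, so the terms are at most
    (M del / [pth])^n. The ratio is below 1 since both rho and 1 are below [pth] / del. *)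
Lemma binom_summable_ramified del : 0 < del < pth R p ->
  binom_summable del (del^-1 * pth R p).
Proof.
move=> /andP[del_gt0 del_lt] rho /andP[rho_ge0 rho_lt].
have th_gt0 := pth_gt0 R p_prime; set th := pth R p in del_lt rho_lt th_gt0 *.
pose M := Num.max rho 1; have M_gt0 : 0 < M by rewrite lt_max ltr01 orbT.
have M_lt : M < del^-1 * th by rewrite gt_max rho_lt mulrC ltr_pdivlMr // mul1r.
apply: (@vanishing_le _ _ (fun n => (M * del / th) ^+ n) 0) => [n _|]; last first.
  apply: vanishing_geom; rewrite divr_ge0 ?mulr_ge0 ?(ltW M_gt0) ?(ltW del_gt0) ?(ltW th_gt0) //=.
  by rewrite ltr_pdivrMr // mul1r -ltr_pdivlMr // mulrC.
rewrite !exprMn mulrAC ler_wpM2r ?exprn_ge0 ?(ltW del_gt0) //.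
rewrite ler_pM ?invr_ge0 ?absp_ge0 ?prodr_ge0 //.
- by move=> i _; rewrite le_max rho_ge0.
- have -> : M ^+ n = \prod_(i < n) M by rewrite prodr_const card_ord.
  apply: ler_prod => i _; rewrite le_max rho_ge0 /= ge_max !le_max lexx /=.
  by apply/orP; right; rewrite abspD_le ?abspN ?absp_nat_le1 ?absp1.
- by rewrite exprVn lef_pV2 ?posrE ?exprn_gt0 ?absp_gt0 ?factCp_neq0 // absp_fact_ge.
Qed.

(** For rho <= p^-M this bounds the numerator factors: divisibility by p counts up to the exponent M
    only. *)
Definition absp_cut M (n : nat) : R := Num.max (p%:R^-1 ^+ M) (absp (n%:R : C)).

Lemma absp_cut_gt0 M n : 0 < absp_cut M n.
Proof. by rewrite lt_max exprn_gt0 // invr_gt0 pR_gt0. Qed.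

(** Cutting off at p^-M loses |j / p^M| exactly at the multiples j of p^M; the lost factors multiply
    up to |(n %/ p^M)!|. *)
Lemma prod_max_le M n :
  \prod_(j < n) absp_cut M j.+1 * absp (((n %/ p ^ M)`!)%:R : C) <= absp ((n`!)%:R : C).
Proof.
have P_gt0 : (0 < p ^ M)%N by rewrite expn_gt0 prime_gt0.
elim: n => [|n IHn]; first by rewrite big_ord0 div0n mul1r.
rewrite big_ord_recr /= factS natrM abspM divnS //; set P := \prod_(i < n) _ in IHn *.
have P_ge0 : 0 <= P by apply: prodr_ge0 => i _; apply/ltW/absp_cut_gt0.
case: (boolP (p ^ M %| n.+1)%N) => [dvd_n|ndvd_n]; last first.
  rewrite add0n mulrAC [leRHS]mulrC ler_pM ?mulr_ge0 ?absp_ge0 ?(ltW (absp_cut_gt0 _ _)) //.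
  rewrite ge_max lexx andbT absp_natE // ler_wiXn2l ?invr_ge0 ?ler0n ?(ltW (pRV_lt1 _ _)) //.
  by move: ndvd_n; rewrite pfactor_dvdn // -ltnNge => /ltnW.
rewrite add1n factS natrM abspM.
have eq_n : n.+1 = ((n %/ p ^ M).+1 * p ^ M)%N.
  by rewrite -[LHS](divnK dvd_n) divnS // dvd_n add1n.
have eq_abs : absp (n.+1%:R : C) = absp ((n %/ p ^ M).+1%:R : C) * p%:R^-1 ^+ M.
  by rewrite {1}eq_n natrM abspM natrX absp_pX.
have -> : absp_cut M n.+1 = p%:R^-1 ^+ M.
  rewrite /absp_cut eq_abs; apply/max_idPl; rewrite ler_piMl ?absp_nat_le1 //.
  by rewrite exprn_ge0 // invr_ge0.
have -> : P * p%:R^-1 ^+ M * (absp ((n %/ p ^ M).+1%:R : C) * absp (((n %/ p ^ M)`!)%:R : C)) =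
  absp ((n %/ p ^ M).+1%:R : C) * p%:R^-1 ^+ M * (P * absp (((n %/ p ^ M)`!)%:R : C)) by ring.
by rewrite eq_abs ler_wpM2l // mulr_ge0 ?absp_ge0 ?exprn_ge0 // invr_ge0.
Qed.

Lemma absp_cut_coprime M n : coprime p n -> absp_cut M n = 1.
Proof.
move=> co_pn; rewrite /absp_cut absp_coprime //; apply/max_idPr.
by rewrite exprn_ile1 ?invr_ge0 ?(ltW (pRV_lt1 _ _)).
Qed.

(* The factors with [i = 0], [i = 1] on the left are [1] and [p^-M], and one of the
   two extra factors on the right is [1]. *)
Lemma prod_max_shift_le M n :
  \prod_(i < n) Num.max (p%:R^-1 ^+ M) (absp (1 - i%:R : C)) <= \prod_(j < n) absp_cut M j.+1.
Proof.
have pM_le1 : p%:R^-1 ^+ M <= 1 :> R by rewrite exprn_ile1 ?invr_ge0 ?(ltW (pRV_lt1 _ _)).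
case: n => [|[|n]]; first by rewrite !big_ord0.
  by rewrite !big_ord1 subr0 absp_cut_coprime ?coprimen1 // absp1 ge_max pM_le1 lexx.
rewrite 2!big_ord_recl /= subr0 absp1 (max_idPr _) // mul1r subrr absp0 (max_idPl _); last first.
  by rewrite exprn_ge0 // invr_ge0.
rewrite 2!big_ord_recr /= -mulrA mulrC.
have -> : \prod_(i < n) Num.max (p%:R^-1 ^+ M) (absp (1 - (lift ord0 (lift ord0 i))%:R : C)) =
    \prod_(i < n) absp_cut M i.+1.
  apply: eq_bigr => i _; rewrite /absp_cut abspB /=; congr (Num.max _ (absp _)).
  by rewrite /bump /= !add1n -[i.+2]addn1 natrD addrK.
rewrite ler_wpM2l //; first by apply: prodr_ge0 => i _; apply/ltW/absp_cut_gt0.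
have [co_p|] := boolP (coprime p n.+1).
  by rewrite absp_cut_coprime // mul1r le_max lexx.
rewrite prime_coprime // negbK => dvd_p.
rewrite [absp_cut M n.+2]absp_cut_coprime ?mulr1 ?le_max ?lexx //.
rewrite prime_coprime //; apply/negP => dvd_p'; have := dvdn_sub dvd_p' dvd_p.
by rewrite subSnn dvdn1 => /eqP p1; move: p_prime; rewrite p1.
Qed.

(** On this disc the bound grows no faster than 1 / |(n %/ p^M)!|, so its exponential rate shrinks
    as M grows. *)
Lemma binom_bound_small M n rho : 0 <= rho <= p%:R^-1 ^+ M ->
  binom_bound n rho * absp (((n %/ p ^ M)`!)%:R : C) <= 1.
Proof.
move=> /andP[rho_ge0 rho_le].
have f_gt0 : 0 < absp ((n`!)%:R : C) by rewrite absp_gt0 factCp_neq0.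
rewrite /binom_bound mulrAC ler_pdivrMr // mul1r; apply: le_trans (prod_max_le M n).
rewrite ler_wpM2r ?absp_ge0 //; apply: le_trans (prod_max_shift_le M n).
apply: ler_prod => i _; rewrite le_max rho_ge0 /= ge_max !le_max rho_le /=.
by rewrite lexx orbT.
Qed.

Lemma pth_ge : p%:R^-1 <= pth R p.
Proof.
rewrite -(pthX R p_prime) -[leRHS]expr1 ler_wiXn2l ?(ltW (pth_gt0 _ _)) ?(ltW (pth_lt1 _ _)) //.
by rewrite -ltnS prednK ?prime_gt0 ?prime_gt1.
Qed.

(** Split del^n = c^n c^n with c the square root of del. If c^(p^M) <= 1/p, one factor is at most
    |(n %/ p^M)!| and absorbs the growth of the bound; the other tends to 0. *)
Lemma binom_summable_small del : 0 <= del < 1 ->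
  exists2 r : R, 0 < r & binom_summable del r.
Proof.
move=> /andP[del_ge0 del_lt1]; pose c := Num.sqrt del.
have c_ge0 : 0 <= c by apply: sqrtr_ge0.
have delE : del = c ^+ 2 by rewrite sqr_sqrtr.
have c_lt1 : c < 1.
  rewrite ltNge; apply/negP => /(exprn_ege1 2); by rewrite -delE leNgt del_lt1.
have pV_gt0 : 0 < p%:R^-1 :> R by rewrite invr_gt0 pR_gt0.
have [|M MP] := @vanishing_geom R c _ _ pV_gt0; first by rewrite c_ge0.
have cM : c ^+ (p ^ M) <= p%:R^-1.
  by apply/ltW/MP/ltnW/ltn_expl/prime_gt1.
exists (p%:R^-1 ^+ M); first exact: exprn_gt0.
move=> rho /andP[rho_ge0 rho_lt].
apply: (@vanishing_le _ _ (fun n => c ^+ n) 0) => [n _|]; last first.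
  by apply: vanishing_geom; rewrite c_ge0.
rewrite delE -exprM mulnC exprM expr2 mulrA ler_piMl ?exprn_ge0 //.
apply: le_trans (@binom_bound_small M n rho _); last by rewrite rho_ge0 ltW.
rewrite ler_wpM2l ?binom_bound_ge0 //; apply: le_trans (absp_fact_ge C p_prime _).
apply: le_trans (_ : c ^+ (p ^ M * (n %/ p ^ M)) <= _).
  by rewrite ler_wiXn2l ?(ltW c_lt1) // mulnC leq_trunc_div.
rewrite exprM; apply: le_trans (_ : p%:R^-1 ^+ (n %/ p ^ M) <= _).
  by rewrite lerXn2r ?nnegrE ?exprn_ge0 // ltW.
by rewrite lerXn2r ?nnegrE ?(ltW (pth_gt0 _ _)) ?pth_ge // ltW.
Qed.

End Binomial.

(** * The expansion of the zeta function *)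

Section Expansion.
Variables (R : realType) (p : nat) (C : padicComplex R p).
Variable iota : {rmorphism algC -> C}.
Hypotheses (p_prime : prime p) (p_odd : odd p).

Lemma fps_mul_geom (F : fieldType) (a b : nat -> F) (s : F) n :
  fps_mul (fun k => a k * s ^+ k) (fun k => b k * s ^+ k) n = fps_mul a b n * s ^+ n.
Proof.
rewrite /fps_mul mulr_suml; apply: eq_bigr => i _.
have le_i : (i <= n)%N by rewrite -ltnS.
by rewrite mulrACA -exprD subnKC.
Qed.

Variables (N : nat) (w : N.-tuple C) (x : C) (del r : R).
Hypotheses (x_neq0 : x != 0) (r_gt0 : 0 < r) (del_lt1 : del < 1).
Hypothesis del_summable : binom_summable C del r.
Hypothesis angle_le : absp (angle iota x - 1) <= del.
Hypothesis dotp_le : forall t, ZpN C N t -> absp (dotp w t / x) <= del.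

Let y := angle iota x.
Let a t := dotp w t / x.
Let h t := y * (1 + a t) - 1.
(** h t = <x + w.t> - 1 equals (y / x) (x (y - 1) / y + w.t), so [J n] is the integral of its n-th
    power; likewise [E j] is the integral of (a t)^j. *)
Let J n := (y / x) ^+ n * eulerp w n (x * (y - 1) / y).
Let E j := x ^- j * eulerp w j 0.

Let del_ge0 : 0 <= del. Proof. exact: le_trans (absp_ge0 _) angle_le. Qed.

Let absp_y : absp y = 1.
Proof.
rewrite -(absp1 C); apply: (@absp_near _ _ _ _ _ 1); last by rewrite absp1.
by rewrite abspB angle_near1.
Qed.

Let y_neq0 : y != 0. Proof. by rewrite -absp_gt0 absp_y. Qed.

Let absp_h t : ZpN C N t -> absp (h t) <= del.
Proof.
move=> Zt; have -> : h t = (y - 1) + y * a t by rewrite /h; ring.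
by rewrite abspD_le // abspM absp_y mul1r dotp_le.
Qed.

Let angle_shift t : ZpN C N t -> angle iota (x + dotp w t) = y * (1 + a t).
Proof.
move=> Zt; rewrite -angleM1 //; last exact: le_lt_trans (dotp_le Zt) del_lt1.
by rewrite mulrDr mulr1 /a mulrC divfK.
Qed.

Let int_h n : is_fermionicN (fun t => h t ^+ n) (J n).
Proof.
have -> : (fun t => h t ^+ n) =
    (fun t => (y / x) ^+ n * (x * (y - 1) / y + dotp w t) ^+ n).
  apply/funext => t; rewrite -exprMn; congr (_ ^+ n).
  by rewrite /h /a; field; rewrite y_neq0.
exact/is_fermionicNZ/is_fermionicN_eulerp.
Qed.

Let int_a n : is_fermionicN (fun t => a t ^+ n) (E n).
Proof.
have -> : (fun t => a t ^+ n) = (fun t => x ^- n * (0 + dotp w t) ^+ n).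
  by apply/funext => t; rewrite add0r -exprVn -exprMn mulrC.
exact/is_fermionicNZ/is_fermionicN_eulerp.
Qed.

Let J_le n : absp (J n) <= del ^+ n.
Proof.
apply: is_fermionicN_le (int_h n) => t Zt.
by rewrite abspX lerXn2r ?nnegrE ?absp_ge0 ?absp_h.
Qed.

Let E_le n : absp (E n) <= del ^+ n.
Proof.
apply: is_fermionicN_le (int_a n) => t Zt.
by rewrite abspX lerXn2r ?nnegrE ?absp_ge0 ?dotp_le.
Qed.

Let e (s : C) n := binom_bound C n (absp s) * del ^+ n.

Let e_vanishing (s : C) : absp s < r -> vanishing (e s).
Proof. by move=> lt_s; apply: del_summable; rewrite absp_ge0. Qed.

Let term_le (s z : C) n : absp z <= del ->
  absp (binomp (1 - s) n * z ^+ n) <= e s n.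
Proof.
move=> z_le; rewrite abspM abspX ler_pM ?exprn_ge0 ?absp_ge0 ?absp_binomp_le //.
by rewrite lerXn2r ?nnegrE ?absp_ge0.
Qed.

(* Here both sides are the integral of [(y (1 + a t)) ^+ m]. *)
Let identity_nat (s : C) m l c : 1 - s = m%:R -> absp s < r ->
  is_sump (fun n => binomp (1 - s) n * J n) l ->
  is_sump (fun n => binomp (1 - s) n * E n) c -> l = y ^+ m * c.
Proof.
move=> def_m lt_s sum_l sum_c.
pose f t := (y * (1 + a t)) ^+ m.
have [l1 l1_sum l1_int] : exists2 l1,
    is_sump (fun n => binomp (1 - s) n * J n) l1 & is_fermionicN f l1.
  apply: (@is_fermionicN_sum _ _ C N (fun n t => binomp (1 - s) n * h t ^+ n) _ f (e s)).
  - exact: e_vanishing.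
  - by move=> n t Zt; apply/term_le/absp_h.
  - by move=> n; apply: is_fermionicNZ.
  - move=> t _; have -> : f t = (1 + h t) ^+ m by rewrite /h [1 + (_ - 1)]addrC subrK.
    by rewrite def_m; apply: is_sump_binomial.
have [l2 l2_sum l2_int] : exists2 l2,
    is_sump (fun n => y ^+ m * (binomp (1 - s) n * E n)) l2 & is_fermionicN f l2.
  apply: (@is_fermionicN_sum _ _ C N
    (fun n t => y ^+ m * (binomp (1 - s) n * a t ^+ n)) _ f (e s)).
  - exact: e_vanishing.
  - move=> n t Zt; rewrite abspM abspX absp_y expr1n mul1r.
    exact/term_le/dotp_le.
  - by move=> n; do 2![apply: is_fermionicNZ].
  - move=> t _; have -> : f t = y ^+ m * (1 + a t) ^+ m by apply: exprMn.
    by rewrite def_m; have := is_sumpZ (y ^+ m) (is_sump_binomial p_prime m (a t)).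
rewrite (is_sump_unique sum_l l1_sum) (is_fermionicN_unique l1_int l2_int).
exact: is_sump_unique l2_sum (is_sumpZ _ sum_c).
Qed.

(** In terms of power series in s, the claim is that the coefficients [cz] of the zeta function are
    the Cauchy product of those of <x>^(1-s), [cb], and of the sum over j, [cc]. *)
Lemma zeta_identity_of_summable : ~ Lambda w x -> zeta_identity iota x w r.
Proof.
move=> xNL.
have [cz czP] := binomp_series_analytic r_gt0 del_summable J_le.
have [cc ccP] := binomp_series_analytic r_gt0 del_summable E_le.
have [cb cbP] : exists c : nat -> C, forall s, absp s < r ->
    exists2 l, is_powp y (1 - s) l & is_sump (fun k => c k * s ^+ k) l.
  apply: (binomp_series_analytic r_gt0 del_summable) => n.
  by rewrite abspX lerXn2r ?nnegrE ?absp_ge0.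
have prod_sum s b c : is_sump (fun k => cb k * s ^+ k) b ->
    is_sump (fun k => cc k * s ^+ k) c -> is_sump (fun k => fps_mul cb cc k * s ^+ k) (b * c).
  by move=> sum_b sum_c; apply: is_sump_ext (is_sump_mul sum_b sum_c) => n; apply: fps_mul_geom.
have eq_c k : cz k = fps_mul cb cc k.
  apply/eqP; rewrite -subr_eq0; apply/eqP; move: k.
  apply: (@identity_theorem _ _ C (fun k => cz k - fps_mul cb cc k) r
    (fun i => - (p ^ i)%:R)) => //.
  - move=> s lt_s; have [l _ sum_l] := czP s lt_s.
    have [b _ sum_b] := cbP s lt_s; have [c _ sum_c] := ccP s lt_s.
    exists (l - b * c); apply: is_sump_ext (is_sumpB sum_l (prod_sum s b c sum_b sum_c)) => k.
    by rewrite mulrBl.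
  - by move=> i; rewrite oppr_eq0 natCp_eq0 // -lt0n expn_gt0 prime_gt0.
  - have := cvgpZ (-1) (cvgp_pX C p_prime); rewrite mulr0.
    by apply: cvgp_ext => i; rewrite mulN1r.
  move=> i lt_i; set s := - _ in lt_i *.
  have [l sum_l sum_l'] := czP s lt_i.
  have [b pow_b sum_b] := cbP s lt_i; have [c sum_c sum_c'] := ccP s lt_i.
  have def_m : 1 - s = (p ^ i).+1%:R by rewrite /s opprK -natr1 addrC.
  have def_b : b = y ^+ (p ^ i).+1.
    apply: (is_sump_unique pow_b); rewrite def_m.
    by have := is_sump_binomial p_prime (p ^ i).+1 (y - 1); rewrite [1 + (_ - 1)]addrC subrK.
  have def_l : l = b * c by rewrite def_b; apply: identity_nat sum_c.
  rewrite -(subrr l) {2}def_l.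
  by apply: is_sump_ext (is_sumpB sum_l' (prod_sum s b c sum_b sum_c')) => k; rewrite mulrBl.
have /choice[F FP] : forall s, exists l, absp s < r ->
    is_sump (fun n => binomp (1 - s) n * J n) l /\ is_sump (fun k => cz k * s ^+ k) l.
  move=> s; have [lt_s|] := boolP (absp s < r); last by exists 0.
  by have [l] := czP s lt_s; exists l.
exists F; split; first by exists cz => s /FP[].
move=> s lt_s; have [F_sum F_pow] := FP s lt_s; split.
  split=> //; have /choice[f fP] : forall t, exists l, ZpN C N t ->
      is_sump (fun n => binomp (1 - s) n * h t ^+ n) l.
    move=> t; have [Zt|] := pselect (ZpN C N t); last by exists 0.
    have [|l l_sum] := @sump_exists _ _ C (fun n => binomp (1 - s) n * h t ^+ n).
      apply: (@vanishing_le _ _ (e s) 0); last exact: e_vanishing.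
      by move=> n _; apply/term_le/absp_h.
    by exists l.
  exists f; split=> [t Zt|]; first by rewrite angle_shift //; apply: fP.
  have [l l_sum l_int] : exists2 l,
      is_sump (fun n => binomp (1 - s) n * J n) l & is_fermionicN f l.
    apply: (@is_fermionicN_sum _ _ C N (fun n t => binomp (1 - s) n * h t ^+ n) _ f (e s)).
    - exact: e_vanishing.
    - by move=> n t Zt; apply/term_le/absp_h.
    - by move=> n; apply: is_fermionicNZ.
    - exact: fP.
  by rewrite (is_sump_unique F_sum l_sum).
have [b pow_b sum_b] := cbP s lt_s; have [c sum_c sum_c'] := ccP s lt_s.
exists b, c; split=> //.
  by apply: is_sump_ext sum_c => n; rewrite /E mulrA mulrAC.
apply: (is_sump_unique F_pow); apply: is_sump_ext (prod_sum s b c sum_b sum_c') => k.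
by rewrite eq_c.
Qed.

End Expansion.

(** * Uniformizers and the size of <y> - 1 in a finite extension of small ramification *)

Section FiniteExtension.
Variables (R : realType) (p : nat) (C : padicComplex R p).
Variables (K : set C) (pi : C) (e : nat).
Hypothesis p_prime : prime p.
Hypotheses (K_field : divring_closed (mem K)) (K_unif : uniformizer K pi).
Hypothesis K_ram : ramification_index K e.

Let K1 : K 1.
Proof. by have [] := K_field; rewrite inE. Qed.
Let KB y z : K y -> K z -> K (y - z).
Proof. by move=> Ky Kz; have [_ /(_ y z)] := K_field; rewrite !inE => /(_ Ky Kz). Qed.
Let Kdiv y z : K y -> K z -> K (y / z).
Proof. by move=> Ky Kz; have [_ _ /(_ y z)] := K_field; rewrite !inE => /(_ Ky Kz). Qed.
Let KM y z : K y -> K z -> K (y * z).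
Proof. by move=> Ky Kz; rewrite -[z]invrK -[z^-1]mul1r; do !apply: Kdiv. Qed.
Let KX y n : K y -> K (y ^+ n).
Proof. by move=> Ky; elim: n => [|n IHn]; rewrite ?exprS //; apply: KM. Qed.
Let KXz y (m : int) : K y -> K (y ^ m).
Proof.
move=> Ky; case: m => n; first exact: KX.
by rewrite NegzE -exprnN -[_ ^- _]mul1r; apply: Kdiv => //; apply: KX.
Qed.
Let Kn n : K n%:R.
Proof.
have K0 : K 0 by rewrite -(subrr 1); apply: KB.
elim: n => [//|n IHn].
by have := KB IHn (KB K0 K1); rewrite sub0r opprK natr1.
Qed.

Lemma principal_absp (z1 z2 : C) : K z1 -> principal K z1 = principal K z2 -> absp z1 <= absp z2.
Proof.
move=> Kz1 eq_z; have : principal K z1 z1.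
  by exists 1; rewrite ?mulr1 //; split; rewrite ?absp1.
by rewrite eq_z => -[c [_ c1] <-]; rewrite abspM ler_piMr ?absp_ge0.
Qed.

Lemma absp_maxideal (z : C) : K z -> absp z < 1 -> absp z <= absp pi.
Proof.
move=> Kz z1; have : maxideal K z by [].
by have [_ <-] := K_unif; move=> -[c [_ c1] <-]; rewrite abspM ler_piMr ?absp_ge0.
Qed.

Lemma absp_unif_lt1 : absp pi < 1.
Proof.
have [[Kpi _] eq_pi] := K_unif; suff : maxideal K pi by case.
by rewrite -eq_pi; exists 1; rewrite ?mulr1 //; split; rewrite ?absp1.
Qed.

(** The uniformizer inside [ramification_index] may differ from [pi], but generators of the same
    ideal have the same absolute value. *)
Lemma absp_unifX : absp pi ^+ e = p%:R^-1.
Proof.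
have [pi' pi'_unif eq_p] := K_ram.
have [[Kpi pi1] eq_pi] := K_unif; have [[Kpi' pi'1] eq_pi'] := pi'_unif.
have -> : absp pi = absp pi'.
  by apply/le_anti; rewrite !principal_absp // eq_pi eq_pi'.
rewrite -abspX -(absp_p C); apply/le_anti.
by rewrite !principal_absp //; apply: KX.
Qed.

Lemma absp_unif_gt0 : 0 < absp pi.
Proof.
rewrite lt_neqAle absp_ge0 andbT eq_sym; apply/eqP => pi0.
have : (p%:R : C) = 0.
  apply/absp_eq0/le_anti; rewrite absp_ge0 andbT -pi0.
  by rewrite absp_maxideal // absp_p pRV_lt1.
by apply/eqP; rewrite natCp_eq0 // gtn_eqF ?prime_gt0.
Qed.

(** |pi|^e = 1/p = [pth]^(p-1), so the smaller exponent belongs to the smaller base. *)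
Lemma absp_unif_lt_pth : (e < p.-1)%N -> absp pi < pth R p.
Proof.
move=> lt_e; rewrite ltNge; apply/negP => le_pi.
have th_gt0 := pth_gt0 R p_prime.
have : pth R p ^+ e <= absp pi ^+ e by rewrite lerXn2r ?nnegrE ?absp_ge0 // ltW.
rewrite absp_unifX -(pthX R p_prime) leNgt => /negP; apply.
by rewrite ltr_iXn2l // pth_lt1.
Qed.

(** No absolute value of K lies strictly between |pi| and 1. For |z| <= 1 take the least n with
    |pi|^(n+1) < |z|; then z / pi^n cannot be smaller than 1. *)
Lemma absp_unif_pow y : K y -> y != 0 -> exists m : int, absp y = absp pi ^ m.
Proof.
have pi_gt0 := absp_unif_gt0; have pi_lt1 := absp_unif_lt1.
have [[Kpi _] _] := K_unif.
have le1_case z : K z -> z != 0 -> absp z <= 1 -> exists n, absp z = absp pi ^+ n.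
  move=> Kz z0 z1; have az_gt0 : 0 < absp z by rewrite absp_gt0.
  have ex_n : exists n, absp pi ^+ n.+1 < absp z.
    have [|n0 n0P] := @vanishing_geom _ (absp pi) _ _ az_gt0; first by rewrite absp_ge0.
    by exists n0; apply: n0P.
  case: (ex_minnP ex_n) => n lt_n min_n; exists n.
  have pin_gt0 : 0 < absp pi ^+ n by rewrite exprn_gt0.
  have le_n : absp z <= absp pi ^+ n.
    case: n min_n {lt_n pin_gt0} => [|n] min_n; first by rewrite expr0.
    by rewrite leNgt; apply/negP => /min_n; rewrite ltnn.
  apply/le_anti; rewrite le_n /= leNgt; apply/negP => lt_z.
  have := @absp_maxideal (z / pi ^+ n).
  rewrite abspM abspV abspX ltr_pdivrMr // mul1r => /(_ _ lt_z).
  rewrite ler_pdivrMr // -exprS leNgt lt_n => H; suff: false by []; apply: H.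
  by apply: Kdiv => //; apply: KX.
move=> Ky y0; have [y1|/ltW y1] := lerP (absp y) 1.
  by have [n ->] := le1_case y Ky y0 y1; exists n.
have [|||n eq_n] := le1_case y^-1.
- by rewrite -[y^-1]mul1r; apply: Kdiv.
- by rewrite invr_eq0.
- by rewrite abspV invf_le1 // absp_gt0.
by exists (- n%:Z); rewrite -exprnN -eq_n abspV invrK.
Qed.

(* Up to roots of unity of order prime to [p], [angle y] has a power of exponent
   prime to [p] in [K]: the denominator of [vp y] divides [e < p]. *)
Lemma angle_unif (iota : {rmorphism algC -> C}) y : K y -> y != 0 -> (e < p.-1)%N ->
  absp (angle iota y - 1) <= absp pi.
Proof.
move=> Ky y0 lt_e; have lt1 := angle_near1 iota p_prime y0.
have [[m [prim_m co_m]] _] := hatpP iota p_prime y0.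
set d := `|denq (vp y)|%N.
have e_gt0 : (0 < e)%N.
  rewrite lt0n; apply/eqP => e0; have := absp_unifX; rewrite e0 expr0 => p1.
  by have := pRV_lt1 R p_prime; rewrite -p1 ltxx.
have d_gt0 : (0 < d)%N by rewrite absz_gt0 denq_neq0.
have dvd_d : (d %| e)%N.
  have [k eq_k] := absp_unif_pow Ky y0.
  have eq_e : absp y ^ e%:Z = p%:R^-1 ^ k by rewrite eq_k exprzAC -exprnP absp_unifX.
  have eq_d : absp y ^ d%:Z = p%:R^-1 ^ numq (vp y).
    rewrite vpE // -(absp_iota_prat iota) -exprnP -abspX -rmorphXn prat_pow.
    by rewrite fmorphXz rmorph_nat absp_exprz absp_p.
  have : numq (vp y) * e%:Z = k * d%:Z.
    apply: (@ieexprIz _ (p%:R^-1 : R)); rewrite ?invr_gt0 ?pR_gt0 ?lt_eqF ?pRV_lt1 //.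
    by rewrite -!exprz_exp -eq_e -eq_d exprzAC.
  move=> /(congr1 absz); rewrite !abszM /= => eq_nd.
  have : (d %| `|numq (vp y)| * e)%N by rewrite eq_nd dvdn_mull.
  by rewrite Gauss_dvdr // coprime_sym coprime_num_den.
have co_d : coprime p (d * m).
  rewrite coprimeMr [coprime p m]coprime_sym co_m andbT prime_coprime //.
  apply/negP => /dvdn_leq -/(_ d_gt0); rewrite leqNgt => /negP; apply.
  by apply: leq_ltn_trans (dvdn_leq e_gt0 dvd_d) _; apply: leq_trans lt_e (leq_pred _).
rewrite -(absp_expr_sub1 p_prime lt1 co_d); apply: absp_maxideal; last first.
  by rewrite absp_expr_sub1.
apply: KB => //.
(* The exponent m removes the root of unity and d turns the rational power of p into an integral
   one, so <y>^(dm) lies in K. *)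
have hat1 : hatp iota y ^+ (d * m) = 1 by rewrite mulnC exprM (prim_expr_order prim_m) expr1n.
rewrite /angle exprMn exprVn hat1 invr1 mulr1 exprMn; apply: KM; last exact: KX.
have -> : d = `|denq (- vp y)|%N by rewrite denqN.
by rewrite exprM -rmorphXn prat_pow fmorphXz rmorph_nat; apply/KX/KXz/Kn.
Qed.

End FiniteExtension.

Theorem theorem3p9 (R : realType) (p : nat) (p_prime : prime p) (p_odd : odd p)
    (C : padicComplex R p) (iota : {rmorphism algC -> C})
    (N : nat) (N_gt0 : (0 < N)%N) (w : N.-tuple C) (x : C)
    (w_neq0 : forall i, tnth w i != 0) (x_neq0 : x != 0)
    (x_large : normp w < absp x) :
  (exists2 r : R, 0 < r & zeta_identity iota x w r) /\
  (forall (K : set C) (e : nat) (pi : C),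
     finite_extension K -> (forall i, K (tnth w i)) -> K x ->
     ramification_index K e -> (e < p.-1)%N -> uniformizer K pi ->
     zeta_identity iota x w ((absp pi)^-1 * p%:R `^ (- (p.-1)%:R^-1))).
Proof.
have x_gt0 : 0 < absp x by rewrite absp_gt0.
have w_le i : absp (tnth w i) <= normp w by apply: le_bigmax.
have norm_ge0 : 0 <= normp w by apply: bigmax_ge_id.
have dotp_le b t : 0 <= b -> (forall i, absp (tnth w i / x) <= b) -> ZpN C N t ->
    absp (dotp w t / x) <= b.
  move=> b_ge0 wb Zt; rewrite mulr_suml; apply: absp_sum_le => // i _.
  rewrite mulrAC abspM (le_trans _ (wb i)) // ler_piMr ?absp_ge0 //.
  by have [] := Zt i.
have wx_le i : absp (tnth w i / x) <= normp w / absp x.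
  by rewrite abspM abspV ler_wpM2r // invr_ge0 ltW.
have norm_lt1 : normp w / absp x < 1 by rewrite ltr_pdivrMr // mul1r.
have normx_ge0 : 0 <= normp w / absp x by rewrite divr_ge0 // ltW.
have xNL : ~ Lambda w x.
  move=> [t Zt tx]; have := dotp_le _ t normx_ge0 wx_le Zt.
  by rewrite tx divff // absp1 leNgt norm_lt1.
split=> [|K e pi [K_field _ _] Kw Kx K_ram lt_e K_unif].
  (* [del] must dominate both |<x> - 1| and all |w_i / x|. *)
  set del := Num.max (absp (angle iota x - 1)) (normp w / absp x).
  have del_lt1 : del < 1 by rewrite gt_max angle_near1.
  have del_ge0 : 0 <= del by rewrite le_max absp_ge0.
  have [|r r_gt0 r_sum] := @binom_summable_small _ _ C p_prime del.
    by rewrite del_ge0.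
  exists r => //; apply: (zeta_identity_of_summable p_prime p_odd x_neq0 r_gt0 del_lt1) => //.
    by rewrite le_max lexx.
  move=> t; apply: dotp_le => // i.
  by rewrite (le_trans (wx_le i)) // le_max lexx orbT.
have pi_gt0 := absp_unif_gt0 p_prime K_field K_unif.
have pi_lt1 := absp_unif_lt1 K_field K_unif.
apply: (zeta_identity_of_summable p_prime p_odd x_neq0 _ pi_lt1) => //.
- by rewrite mulr_gt0 ?invr_gt0 // (pth_gt0 R p_prime).
- apply: binom_summable_ramified => //.
  by rewrite pi_gt0 (absp_unif_lt_pth p_prime K_field K_unif K_ram).
- exact: (angle_unif p_prime K_field K_unif K_ram).
move=> t; apply: dotp_le => [|i]; first exact: ltW.
(* Each w_i / x lies in the maximal ideal of K, which sharpens < 1 to <= |pi|. *)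
apply: (absp_maxideal K_unif); last exact: le_lt_trans (wx_le i) norm_lt1.
have [_ _ /(_ (tnth w i) x)] := K_field; rewrite !inE; apply=> //; exact: Kw.
Qed.
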